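(* (The formal PBW theorem.) For each $D\in\{D_4,E_6,E_7,E_8\}$, the algebra $\widehat{\mathbf{H}}$ is a flat formal deformation (over the formal parameters $\tau$) of the algebra $B$.
   Context: To $D$ attach integers $m$ and $(d_1,\dots,d_m)$: for $D_4$, $m=4$ and $(2,2,2,2)$; for $E_6$, $m=3$ and $(3,3,3)$; for $E_7$, $m=3$ and $(2,4,4)$; for $E_8$, $m=3$ and $(2,3,6)$. Let $q$ be an invertible variable. $B$ is the algebra over $\mathbb{C}[q,q^{-1}]$ generated by $T_1,\dots,T_m$ with defining relations $T_k^{d_k}=1$ ($k=1,\dots,m$) and $T_1\cdots T_m=q$. Let $\tau=(\tau_{kj})$, $1\le k\le m$, $1\le j\le d_k$, be formal parameters subject to $\sum_{j}\tau_{kj}=0$ for every $k$; put $t_{kj}=e^{\tau_{kj}}$ (so $\prod_j t_{kj}=1$) and $u_{kj}=e^{2\pi \mathrm{i}j/d_k}t_{kj}$, with $\mathrm{i}=\sqrt{-1}$. $\widehat{\mathbf{H}}$ is the algebra topologically generated over $\mathbb{C}[q,q^{-1}][[\tau]]$ by $T_1,\dots,T_m$ with defining relations $$\prod_{j=1}^{d_k}(T_k-u_{kj})=0\ (k=1,\dots,m),\qquad \prod_{k=1}^m T_k=T_1T_2\cdots T_m=q .$$ A flat formal deformation of an algebra $A_0$ over a formal power series ring $\mathbb{C}[[\tau]]$ with maximal ideal $J$ is a ($J$-adically complete, topologically) flat $\mathbb{C}[[\tau]]$-algebra $A$ together with an isomorphism $A/JA\cong A_0$. Here $\widehat{\mathbf{H}}/J\widehat{\mathbf{H}}=B$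 by the definitions. *)

(* Defs.v *)
From HB Require Import structures.
From mathcomp Require Import all_boot all_order all_algebra.
From mathcomp.multinomials Require Import monalg.
From mathcomp Require Import boolp reals complex.
From mathcomp Require trigo.

Set Implicit Arguments.
Unset Strict Implicit.
Unset Printing Implicit Defensive.
Import Order.TTheory GRing.Theory Num.Theory.
Local Open Scope ring_scope.
Local Open Scope quotient_scope.

(** The library's [idealr] and [{ideal_quot _}] only cover proper ideals of
    commutative rings. *)

HB.mixin Record isTwoSided (A : pzRingType) (S : A -> bool) := {
  ideal_mulL : forall a, {in S, forall x, a * x \in S};
  ideal_mulR : forall a, {in S, forall x, x * a \in S}
}.

#[short(type="twosided")]
HB.structure Definition TwoSided (A : pzRingType) :=
  {S of GRing.ZmodClosed A S & isTwoSided A S}.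

Section QuotientRing.
Variables (A : pzRingType) (S : twosided A).

Definition quot_ring : Type := Quotient.quot S.
HB.instance Definition _ := GRing.Zmodule.on quot_ring.

Definition quot_proj (x : A) : quot_ring := \pi_(Quotient.quot S) x.
Definition quot_lift (x : quot_ring) : A := repr (x : Quotient.quot S).

Lemma quot_liftK (x : quot_ring) : quot_proj (quot_lift x) = x.
Proof. exact: reprK. Qed.

Lemma quot_proj_eq (x y : A) : quot_proj x = quot_proj y <-> x - y \in S.
Proof. by rewrite Quotient.idealrBE; split=> [/eqP|/eqP]. Qed.

Lemma quot_lift_sub (x : A) : quot_lift (quot_proj x) - x \in S.
Proof. by apply/quot_proj_eq; rewrite quot_liftK. Qed.

Lemma quot_proj_zmod : zmod_morphism quot_proj.
Proof. exact: (raddfB \pi_(Quotient.quot S)). Qed.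

HB.instance Definition _ :=
  GRing.isZmodMorphism.Build A quot_ring quot_proj quot_proj_zmod.

Definition quot_mul (x y : quot_ring) : quot_ring :=
  quot_proj (quot_lift x * quot_lift y).

Lemma quot_mulE (x y : A) :
  quot_mul (quot_proj x) (quot_proj y) = quot_proj (x * y).
Proof.
apply/quot_proj_eq; set x' := quot_lift _; set y' := quot_lift _.
have -> : x' * y' - x * y = (x' - x) * y' + x * (y' - y).
  by rewrite mulrBl mulrBr addrA subrK.
apply: rpredD; [apply: ideal_mulR|apply: ideal_mulL]; exact: quot_lift_sub.
Qed.

Lemma quot_mulA : associative quot_mul.
Proof.
move=> x y z; rewrite -[x]quot_liftK -[y]quot_liftK -[z]quot_liftK.
by rewrite !quot_mulE mulrA.
Qed.

Lemma quot_mul1 : left_id (quot_proj 1) quot_mul.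
Proof. by move=> x; rewrite -[x]quot_liftK quot_mulE mul1r. Qed.

Lemma quot_mulr1 : right_id (quot_proj 1) quot_mul.
Proof. by move=> x; rewrite -[x]quot_liftK quot_mulE mulr1. Qed.

Lemma quot_mulDl : left_distributive quot_mul +%R.
Proof.
move=> x y z; rewrite -[x]quot_liftK -[y]quot_liftK -[z]quot_liftK.
by rewrite -raddfD !quot_mulE mulrDl raddfD.
Qed.

Lemma quot_mulDr : right_distributive quot_mul +%R.
Proof.
move=> x y z; rewrite -[x]quot_liftK -[y]quot_liftK -[z]quot_liftK.
by rewrite -raddfD !quot_mulE mulrDr raddfD.
Qed.

HB.instance Definition _ := GRing.Zmodule_isPzRing.Build quot_ring
  quot_mulA quot_mul1 quot_mulr1 quot_mulDl quot_mulDr.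

Lemma quot_proj_monoid : monoid_morphism quot_proj.
Proof. by split=> // x y; rewrite -quot_mulE. Qed.

HB.instance Definition _ :=
  GRing.isMonoidMorphism.Build A quot_ring quot_proj quot_proj_monoid.
End QuotientRing.

Section QuotientComRing.
Variables (A : comPzRingType) (S : twosided A).

Lemma quot_mulC : commutative (@quot_mul A S).
Proof.
move=> x y; rewrite -[x]quot_liftK -[y]quot_liftK.
by rewrite !quot_mulE mulrC.
Qed.

HB.instance Definition _ :=
  GRing.PzRing_hasCommutativeMul.Build (quot_ring S) quot_mulC.
End QuotientComRing.

Section GeneratedIdeal.
Variables (A : pzRingType) (X : A -> Prop).

Inductive generated : A -> Prop :=
| generated0 : generated 0
| generatedD a x b y : X x -> generated y -> generated (a * x * b + y).

Definition ideal_of : {pred A} := fun x => `[< generated x >].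

Lemma ideal_of_zmod : zmod_closed ideal_of.
Proof.
split=> [|x y /asboolP gx /asboolP gy]; first exact/asboolP/generated0.
apply/asboolP; elim: gx => [|a u b v Xu _ IH]; last first.
  by rewrite -addrA; apply: generatedD.
rewrite sub0r; elim: gy => [|a u b v Xu _ IH].
  by rewrite oppr0; apply: generated0.
by rewrite opprD -!mulNr; apply: generatedD.
Qed.

HB.instance Definition _ := GRing.isZmodClosed.Build A ideal_of ideal_of_zmod.

Lemma ideal_of_mulL a : {in ideal_of, forall x, a * x \in ideal_of}.
Proof.
move=> x /asboolP gx; apply/asboolP; elim: gx => [|b u c v Xu _ IH].
  by rewrite mulr0; apply: generated0.
by rewrite mulrDr !mulrA; apply: generatedD.
Qed.

Lemma ideal_of_mulR a : {in ideal_of, forall x, x * a \in ideal_of}.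
Proof.
move=> x /asboolP gx; apply/asboolP; elim: gx => [|b u c v Xu _ IH].
  by rewrite mul0r; apply: generated0.
by rewrite mulrDl -mulrA; apply: generatedD.
Qed.

HB.instance Definition _ :=
  isTwoSided.Build A ideal_of ideal_of_mulL ideal_of_mulR.
End GeneratedIdeal.

(** [algType] is not used because it requires [1 != 0], which for a ring
    given by generators and relations is not known a priori. *)

Record algebra (K : comPzRingType) := Algebra {
  alg_ring :> pzRingType;
  alg_scalar : {rmorphism K -> alg_ring};
  alg_central : forall c (a : alg_ring), alg_scalar c * a = a * alg_scalar c
}.

Definition alg_iso (K : comPzRingType) (A B : algebra K)
    (phi : {rmorphism A -> B}) : Prop :=
  bijective phi /\ forall c, phi (alg_scalar A c) = alg_scalar B c.

Section AlgebraConstructions.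
Variables (K : comPzRingType) (A : algebra K).

Program Definition quot_alg (S : twosided A) : algebra K :=
  @Algebra K (quot_ring S) (@quot_proj A S \o @alg_scalar K A) _.
Next Obligation.
move=> S c a /=; rewrite -[a]quot_liftK -!rmorphM; congr quot_proj.
exact: alg_central.
Qed.

Program Definition restrict (K' : comPzRingType) (f : {rmorphism K' -> K}) :
    algebra K' :=
  @Algebra K' A (@alg_scalar K A \o f) _.
Next Obligation. by move=> K' f c a /=; apply: alg_central. Qed.

Definition to_restrict (K' : comPzRingType) (f : {rmorphism K' -> K}) (a : A) :
  restrict f := a.

Definition mod_of : Type := A.
HB.instance Definition _ := GRing.Zmodule.on mod_of.

Definition mod_scale (c : K) (a : mod_of) : mod_of := alg_scalar A c * a.

Fact mod_scaleA a b v : mod_scale a (mod_scale b v) = mod_scale (a * b) v.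
Proof. by rewrite /mod_scale rmorphM mulrA. Qed.
Fact mod_scale1 : left_id 1 mod_scale.
Proof. by move=> v; rewrite /mod_scale rmorph1 mul1r. Qed.
Fact mod_scaleDr : right_distributive mod_scale +%R.
Proof. by move=> a u v; rewrite /mod_scale mulrDr. Qed.
Fact mod_scaleDl v : {morph mod_scale^~ v : a b / a + b}.
Proof. by move=> a b; rewrite /mod_scale rmorphD mulrDl. Qed.

HB.instance Definition _ := GRing.Zmodule_isLmodule.Build K mod_of
  mod_scaleA mod_scale1 mod_scaleDr mod_scaleDl.
End AlgebraConstructions.

Section Adic.
Variables (K : comPzRingType) (J : twosided K).

Section AdicFiltration.
Variable V : lmodType K.

Inductive adicP : nat -> V -> Prop :=
| adicP_all v : adicP 0 v
| adicP_zero n : adicP n.+1 0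
| adicP_add n r v w :
    r \in J -> adicP n v -> adicP n.+1 w -> adicP n.+1 (r *: v + w).

(** The submodule [J^n V]. *)
Definition adic (n : nat) : {pred V} := fun v => `[< adicP n v >].

Lemma adicP_lin n a u v : adicP n u -> adicP n v -> adicP n (a *: u + v).
Proof.
move=> hu; elim: hu a v => {n u} [u|n|n r u w Jr hu _ _ IH] a v hv.
- exact: adicP_all.
- by rewrite scaler0 add0r.
rewrite scalerDr scalerA -addrA; apply: adicP_add => //.
  exact: ideal_mulL.
exact: IH.
Qed.

Lemma adicP0 n : adicP n 0.
Proof. by case: n => [|n]; [apply: adicP_all | apply: adicP_zero]. Qed.

Lemma adic_submod n : subsemimod_closed (adic n).
Proof.
split=> [|a v /asboolP hv].
  split=> [|u v /asboolP hu /asboolP hv]; apply/asboolP; first exact: adicP0.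
  by rewrite -[u]scale1r; apply: adicP_lin.
by apply/asboolP; rewrite -[_ *: _]addr0; apply: adicP_lin (adicP0 n).
Qed.

HB.instance Definition _ n :=
  GRing.isSubmodClosed.Build K V (adic n) (adic_submod n).

Lemma zmod_closed_adic n : zmod_closed (adic n).
Proof. by split=> [|u v hu hv]; rewrite ?rpred0 ?rpredB. Qed.

Definition separated : Prop := forall v : V, (forall n, v \in adic n) -> v = 0.
Definition cauchy_complete : Prop := forall u : nat -> V,
  (forall n, u n.+1 - u n \in adic n) ->
  exists v, forall n, v - u n \in adic n.

(** Bijectivity of [V -> lim V / J^n V]. *)
Definition adically_complete : Prop := separated /\ cauchy_complete.
End AdicFiltration.

Definition ideal_pow (n : nat) : {pred K} := adic (V := K^o) n.

Lemma ideal_pow_zmod n : zmod_closed (ideal_pow n).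
Proof. exact: (zmod_closed_adic K^o). Qed.

HB.instance Definition _ n :=
  GRing.isZmodClosed.Build K (ideal_pow n) (ideal_pow_zmod n).

Lemma ideal_powM n a : {in ideal_pow n, forall x, a * x \in ideal_pow n}.
Proof. by move=> x xJ; apply: (@rpredZ _ K^o). Qed.

Lemma ideal_powMr n a : {in ideal_pow n, forall x, x * a \in ideal_pow n}.
Proof. by move=> x xJ; rewrite mulrC; apply: ideal_powM. Qed.

HB.instance Definition _ n :=
  isTwoSided.Build K (ideal_pow n) (@ideal_powM n) (@ideal_powMr n).

Lemma ideal_pow_scale (V : lmodType K) n r (v : V) :
  r \in ideal_pow n -> r *: v \in adic n.
Proof.
move=> /asboolP hr; apply/asboolP; elim: hr v => {n r} [r|n|n s t w Js ht IHt _ IHw] v.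
- exact: adicP_all.
- by rewrite scale0r; apply: adicP_zero.
by rewrite scalerDl -scalerA; apply: adicP_add.
Qed.

(** [V / J^n V], as a module over [K / J^n]. *)
Section AdicQuotient.
Variables (V : lmodType K) (n : nat).
Local Notation Kn := (quot_ring (ideal_pow n)).

Definition adic_quot : Type := Quotient.quot (adic (V := V) n).
HB.instance Definition _ := GRing.Zmodule.on adic_quot.

Definition adic_proj (v : V) : adic_quot := \pi_(Quotient.quot (adic n)) v.
Definition adic_lift (v : adic_quot) : V := repr (v : Quotient.quot (adic n)).

Lemma adic_liftK v : adic_proj (adic_lift v) = v.
Proof. exact: reprK. Qed.

Lemma adic_proj_eq u v : adic_proj u = adic_proj v <-> u - v \in adic n.
Proof. by rewrite Quotient.idealrBE; split=> [/eqP|/eqP]. Qed.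

Lemma adic_proj_zmod : zmod_morphism adic_proj.
Proof. exact: (raddfB \pi_(Quotient.quot (adic n))). Qed.

HB.instance Definition _ :=
  GRing.isZmodMorphism.Build V adic_quot adic_proj adic_proj_zmod.

Definition adic_scale (c : Kn) (v : adic_quot) : adic_quot :=
  adic_proj (quot_lift c *: adic_lift v).

Lemma adic_scaleE c v :
  adic_scale (quot_proj _ c) (adic_proj v) = adic_proj (c *: v).
Proof.
apply/adic_proj_eq; set c' := quot_lift _; set v' := adic_lift _.
have -> : c' *: v' - c *: v = (c' - c) *: v' + c *: (v' - v).
  by rewrite scalerBl scalerBr addrA subrK.
apply: rpredD; first by apply: ideal_pow_scale; apply: quot_lift_sub.
by apply: rpredZ; apply/adic_proj_eq; rewrite adic_liftK.
Qed.

Fact adic_scaleA a b v : adic_scale a (adic_scale b v) = adic_scale (a * b) v.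
Proof.
rewrite -[a]quot_liftK -[b]quot_liftK -[v]adic_liftK.
by rewrite -rmorphM !adic_scaleE scalerA.
Qed.

Fact adic_scale1 : left_id 1 adic_scale.
Proof.
by move=> v; rewrite -[v]adic_liftK -(rmorph1 (quot_proj _)) adic_scaleE scale1r.
Qed.

Fact adic_scaleDr : right_distributive adic_scale +%R.
Proof.
move=> a u v; rewrite -[a]quot_liftK -[u]adic_liftK -[v]adic_liftK.
by rewrite -raddfD !adic_scaleE scalerDr raddfD.
Qed.

Fact adic_scaleDl v : {morph adic_scale^~ v : a b / a + b}.
Proof.
move=> a b; rewrite -[a]quot_liftK -[b]quot_liftK -[v]adic_liftK.
by rewrite -rmorphD !adic_scaleE scalerDl raddfD.
Qed.

HB.instance Definition _ := GRing.Zmodule_isLmodule.Build Kn adic_quot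
  adic_scaleA adic_scale1 adic_scaleDr adic_scaleDl.
End AdicQuotient.
End Adic.

Section Flatness.
Variable K : comPzRingType.

Definition bilinear_map (M V P : lmodType K) (b : M -> V -> P) : Prop :=
  (forall v, linear (b^~ v)) /\ (forall m, linear (b m)).

(** The element [\sum_i m_i (x) v_i] of the tensor product of [M] and [V]
    over [K] vanishes iff every bilinear map kills it. *)
Definition tensor_eq0 (M V : lmodType K) (s : seq (M * V)) : Prop :=
  forall (P : lmodType K) (b : M -> V -> P), bilinear_map b ->
  \sum_(x <- s) b x.1 x.2 = 0.

(** Tensoring with [V] preserves injectivity of linear maps. *)
Definition flat (V : lmodType K) : Prop :=
  forall (M M' : lmodType K) (f : {linear M -> M'}), injective f ->
  forall s : seq (M * V),
  tensor_eq0 [seq (f x.1, x.2) | x <- s] -> tensor_eq0 s.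
End Flatness.

(** [V / J^n V] is flat over [K / J^n] for every [n]. *)
Definition topologically_flat (K : comPzRingType) (J : twosided K)
    (V : lmodType K) : Prop :=
  forall n, flat (adic_quot J V n).

Section AdicAlgebra.
Variables (K : comPzRingType) (J : twosided K) (A : algebra K).

Definition adic_ideal (n : nat) : {pred A} := adic J (V := mod_of A) n.

Lemma adic_ideal_zmod n : zmod_closed (adic_ideal n).
Proof. exact: (zmod_closed_adic J (mod_of A)). Qed.

HB.instance Definition _ n :=
  GRing.isZmodClosed.Build A (adic_ideal n) (adic_ideal_zmod n).

Lemma adic_ideal_mulR n a : {in adic_ideal n, forall x, x * a \in adic_ideal n}.
Proof.
move=> x /asboolP hx; apply/asboolP.
elim: hx => {n x} [x|n|n r v w Jr _ IHv _ IHw].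
- exact: adicP_all.
- by rewrite mul0r; apply: adicP_zero.
rewrite mulrDl -[X in X + _]mulrA.
exact: (@adicP_add K J (mod_of A)).
Qed.

Lemma adic_ideal_mulL n a : {in adic_ideal n, forall x, a * x \in adic_ideal n}.
Proof.
move=> x /asboolP hx; apply/asboolP.
elim: hx => {n x} [x|n|n r v w Jr _ IHv _ IHw].
- exact: adicP_all.
- by rewrite mulr0; apply: adicP_zero.
rewrite mulrDr [X in X + _]mulrA -alg_central -[X in X + _]mulrA.
exact: (@adicP_add K J (mod_of A)).
Qed.

HB.instance Definition _ n := isTwoSided.Build A (adic_ideal n)
  (@adic_ideal_mulL n) (@adic_ideal_mulR n).

Definition adic_closure (S : twosided A) : {pred A} := fun x =>
  `[< forall n, exists2 y, y \in S & x - y \in adic_ideal n >].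

Variable S : twosided A.

Lemma adic_closure_zmod : zmod_closed (adic_closure S).
Proof.
split=> [|x y /asboolP hx /asboolP hy]; apply/asboolP => n.
  by exists 0; rewrite ?subr0 ?rpred0.
have [x' Sx' hx'] := hx n; have [y' Sy' hy'] := hy n.
exists (x' - y'); first exact: rpredB.
have -> : x - y - (x' - y') = (x - x') - (y - y').
  by rewrite !opprB addrACA [RHS]addrACA (addrC (- y)).
exact: rpredB.
Qed.

HB.instance Definition _ :=
  GRing.isZmodClosed.Build A (adic_closure S) adic_closure_zmod.

Lemma adic_closure_mulL a :
  {in adic_closure S, forall x, a * x \in adic_closure S}.
Proof.
move=> x /asboolP hx; apply/asboolP => n; have [y Sy hy] := hx n.
exists (a * y); first exact: ideal_mulL.
by rewrite -mulrBr; apply: ideal_mulL.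
Qed.

Lemma adic_closure_mulR a :
  {in adic_closure S, forall x, x * a \in adic_closure S}.
Proof.
move=> x /asboolP hx; apply/asboolP => n; have [y Sy hy] := hx n.
exists (y * a); first exact: ideal_mulR.
by rewrite -mulrBl; apply: ideal_mulR.
Qed.

HB.instance Definition _ := isTwoSided.Build A (adic_closure S)
  adic_closure_mulL adic_closure_mulR.
End AdicAlgebra.
Arguments adic_ideal {K} J A n.
Arguments adic_closure {K} J {A} S.

(** Power series in commuting variables indexed by a finite type; the
    coefficients may be noncommutative and commute with the variables. *)

Section Exponents.
Variable I : finType.
Implicit Types d e : {ffun I -> nat}.

Definition expo_sub e d : {ffun I -> nat} := [ffun i => (e i - d i)%N].

(** The exponents [d <= e]. *)
Definition below e : seq {ffun I -> nat} :=
  [seq [ffun i => h i : nat] | h : {dffun forall i, 'I_(e i).+1}].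

Lemma mem_below e d : (d \in below e) = [forall i, d i <= e i]%N.
Proof.
apply/imageP/forallP => [[h _ ->] i|de]; first by rewrite ffunE -ltnS.
exists [ffun i => inord (d i) : 'I_(e i).+1] => //.
by apply/ffunP => i; rewrite !ffunE inordK ?ltnS.
Qed.

Lemma below_uniq e : uniq (below e).
Proof.
rewrite map_inj_uniq ?enum_uniq // => g h /ffunP gh.
by apply/ffunP => i; apply: val_inj; have := gh i; rewrite !ffunE.
Qed.

Lemma belowP e d : reflect (forall i, d i <= e i)%N (d \in below e).
Proof. by rewrite mem_below; apply: forallP. Qed.

Lemma below_sub e d : expo_sub e d \in below e.
Proof. by apply/belowP => i; rewrite ffunE leq_subr. Qed.

Lemma expo_subK e d : d \in below e -> expo_sub e (expo_sub e d) = d.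
Proof. by move=> /belowP de; apply/ffunP => i; rewrite !ffunE subKn. Qed.

Lemma expo_sub0 e : expo_sub e 0 = e.
Proof. by apply/ffunP => i; rewrite !ffunE subn0. Qed.

Lemma below0 e : 0 \in below e.
Proof. by apply/belowP => i; rewrite ffunE. Qed.

Lemma perm_below_sub e : perm_eq (below e) [seq expo_sub e d | d <- below e].
Proof.
apply: uniq_perm; first exact: below_uniq.
  rewrite map_inj_in_uniq ?below_uniq // => c d ce de cd.
  by rewrite -(expo_subK ce) cd expo_subK.
move=> d; apply/idP/mapP => [de|[c _ ->]]; last exact: below_sub.
by exists (expo_sub e d); rewrite ?below_sub ?expo_subK.
Qed.

Lemma perm_below_add e d : d \in below e ->
  perm_eq [seq c <- below e | d \in below c]
          [seq (d + c : {ffun I -> nat}) | c <- below (expo_sub e d)].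
Proof.
move=> /belowP de; apply: uniq_perm; first by rewrite filter_uniq ?below_uniq.
  rewrite map_inj_uniq ?below_uniq // => b c /ffunP bc.
  by apply/ffunP => i; have := bc i; rewrite !ffunE => /addnI.
move=> c; rewrite mem_filter; apply/andP/mapP => [[/belowP dc /belowP ce]|].
  exists (expo_sub c d).
    by apply/belowP => i; rewrite !ffunE leq_sub2r.
  by apply/ffunP => i; rewrite !ffunE; apply/esym/subnKC.
move=> [b /belowP be ->]; split; apply/belowP => i; rewrite !ffunE.
  exact: leq_addr.
by have := be i; rewrite ffunE leq_subRL ?de.
Qed.

Lemma perm_below_trans e d : d \in below e ->
  perm_eq (below d) [seq c <- below e | c \in below d].
Proof.
move=> /belowP de; apply: uniq_perm; rewrite ?filter_uniq ?below_uniq //.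
move=> c; rewrite mem_filter; case: belowP => //= cd; apply/esym/belowP => i.
exact: leq_trans (cd i) (de i).
Qed.
End Exponents.

Section Series.
Variables (I : finType) (A : pzRingType).

Record series := Series { coef : {ffun I -> nat} -> A }.

HB.instance Definition _ := gen_eqMixin series.
HB.instance Definition _ := gen_choiceMixin series.

Lemma seriesP (f g : series) : (forall e, coef f e = coef g e) <-> f = g.
Proof.
split=> [|-> //]; case: f g => [f] [g] /= fg.
by congr Series; apply/funext.
Qed.

Definition series_zero := Series (fun=> 0).
Definition series_opp f := Series (fun e => - coef f e).
Definition series_add f g := Series (fun e => coef f e + coef g e).

Fact series_addA : associative series_add.
Proof. by move=> f g h; apply/seriesP => e; apply: addrA. Qed.
Fact series_addC : commutative series_add.
Proof. by move=> f g; apply/seriesP => e; apply: addrC. Qed.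
Fact series_add0 : left_id series_zero series_add.
Proof. by move=> f; apply/seriesP => e; apply: add0r. Qed.
Fact series_addN : left_inverse series_zero series_opp series_add.
Proof. by move=> f; apply/seriesP => e; apply: addNr. Qed.

HB.instance Definition _ := GRing.isZmodule.Build series
  series_addA series_addC series_add0 series_addN.

Definition seriesC (a : A) := Series (fun e => if e == 0 then a else 0).

Definition series_mul f g :=
  Series (fun e => \sum_(d <- below e) coef f d * coef g (expo_sub e d)).

Fact series_mulA : associative series_mul.
Proof.
move=> f g h; apply/seriesP => e /=; apply/esym.
transitivity (\sum_(c <- below e) \sum_(d <- below e | d \in below c)
    coef f d * coef g (expo_sub c d) * coef h (expo_sub e c)).
  apply: eq_big_seq => c ce.
  by rewrite mulr_suml (perm_big _ (perm_below_trans ce)) big_filter.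
rewrite (exchange_big_dep predT) //=; apply: eq_big_seq => d de.
rewrite -big_filter (perm_big _ (perm_below_add de)) big_map mulr_sumr.
apply: eq_bigr => c _; rewrite -mulrA; congr (_ * (coef g _ * coef h _)).
  by apply/ffunP => i; rewrite !ffunE addKn.
by apply/ffunP => i; rewrite !ffunE subnDA.
Qed.

Fact series_mul1 : left_id (seriesC 1) series_mul.
Proof.
move=> f; apply/seriesP => e /=.
rewrite (bigD1_seq 0) ?below0 ?below_uniq //= eqxx mul1r expo_sub0.
by rewrite big1 ?addr0 // => d /negPf->; rewrite mul0r.
Qed.

Lemma series_mul_comm f g :
  (forall d e, coef f d * coef g e = coef g e * coef f d) ->
  series_mul f g = series_mul g f.
Proof.
move=> fg; apply/seriesP => e /=.
rewrite (perm_big _ (perm_below_sub e)) big_map; apply: eq_big_seq => d de.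
by rewrite expo_subK.
Qed.

Fact series_mulr1 : right_id (seriesC 1) series_mul.
Proof.
move=> f; rewrite series_mul_comm ?series_mul1 // => d e /=.
by case: ifP; rewrite ?mulr1 ?mul1r ?mulr0 ?mul0r.
Qed.

Fact series_mulDl : left_distributive series_mul +%R.
Proof.
move=> f g h; apply/seriesP => e /=; rewrite -big_split /=.
by apply: eq_bigr => d _; rewrite mulrDl.
Qed.

Fact series_mulDr : right_distributive series_mul +%R.
Proof.
move=> f g h; apply/seriesP => e /=; rewrite -big_split /=.
by apply: eq_bigr => d _; rewrite mulrDr.
Qed.

HB.instance Definition _ := GRing.Zmodule_isPzRing.Build series
  series_mulA series_mul1 series_mulr1 series_mulDl series_mulDr.

Fact seriesC_zmod : zmod_morphism seriesC.
Proof.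
by move=> a b; apply/seriesP => e /=; case: ifP => //; rewrite subrr.
Qed.
HB.instance Definition _ :=
  GRing.isZmodMorphism.Build A series seriesC seriesC_zmod.

Fact seriesC_monoid : monoid_morphism seriesC.
Proof.
split=> // a b; apply/seriesP => e /=; rewrite (bigD1_seq 0) ?below0 ?below_uniq //=.
rewrite eqxx expo_sub0 big1 ?addr0 => [|d /negPf->]; last by rewrite mul0r.
by case: ifP; rewrite ?mulr0.
Qed.
HB.instance Definition _ :=
  GRing.isMonoidMorphism.Build A series seriesC seriesC_monoid.

Definition seriesX (i : I) : series :=
  Series (fun e => (e == [ffun j => (j == i) : nat])%:R).
End Series.

Section SeriesCom.
Variables (I : finType) (A : comPzRingType).

Fact series_mulC : commutative (@series_mul I A).
Proof. by move=> f g; apply: series_mul_comm => d e; apply: mulrC. Qed.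

HB.instance Definition _ :=
  GRing.PzRing_hasCommutativeMul.Build (series I A) series_mulC.

Definition aug_ideal : {pred series I A} := fun f => coef f 0 == 0.

Fact aug_ideal_zmod : zmod_closed aug_ideal.
Proof.
split=> [|f g /eqP hf /eqP hg]; apply/eqP => //=.
by rewrite hf hg subrr.
Qed.
HB.instance Definition _ :=
  GRing.isZmodClosed.Build (series I A) aug_ideal aug_ideal_zmod.

Lemma coefM0 (f g : series I A) : coef (f * g) 0 = coef f 0 * coef g 0.
Proof.
rewrite /= (bigD1_seq 0) ?below0 ?below_uniq //= expo_sub0 big1_seq ?addr0 //.
move=> d /andP[d0 /belowP d_le]; case/eqP: d0; apply/ffunP => i.
by apply/eqP; have := d_le i; rewrite ffunE leqn0.
Qed.

Fact aug_ideal_mulL a : {in aug_ideal, forall f, a * f \in aug_ideal}.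
Proof. by move=> f /eqP hf; apply/eqP; rewrite coefM0 hf mulr0. Qed.
Fact aug_ideal_mulR a : {in aug_ideal, forall f, f * a \in aug_ideal}.
Proof. by move=> f /eqP hf; apply/eqP; rewrite coefM0 hf mul0r. Qed.
HB.instance Definition _ := isTwoSided.Build (series I A) aug_ideal
  aug_ideal_mulL aug_ideal_mulR.
End SeriesCom.
Arguments aug_ideal I A : clear implicits.

Section SeriesMap.
Variables (I : finType) (A B : pzRingType) (f : {rmorphism A -> B}).

Definition series_map (s : series I A) : series I B :=
  Series (fun e => f (coef s e)).

Fact series_map_zmod : zmod_morphism series_map.
Proof. by move=> s t; apply/seriesP => e; apply: rmorphB. Qed.
HB.instance Definition _ := GRing.isZmodMorphism.Build
  (series I A) (series I B) series_map series_map_zmod.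

Fact series_map_monoid : monoid_morphism series_map.
Proof.
split=> [|s t]; apply/seriesP => e /=.
  by case: ifP; rewrite ?rmorph1 ?rmorph0.
by rewrite rmorph_sum; apply: eq_bigr => d _; rewrite rmorphM.
Qed.
HB.instance Definition _ := GRing.isMonoidMorphism.Build
  (series I A) (series I B) series_map series_map_monoid.
End SeriesMap.

Program Definition series_alg (I : finType) (K : comPzRingType)
    (A : algebra K) : algebra (series I K) :=
  @Algebra (series I K) (series I A) (@series_map I _ _ (@alg_scalar K A)) _.
Next Obligation.
move=> I K A c a; apply: series_mul_comm => d e /=; exact: alg_central.
Qed.

(** [exp f] for [f] without constant term: [f ^+ n] has no terms of degree
    less than [n], so that the exponential sum may be cut at the degree of
    the exponent. *)
Definition series_exp (I : finType) (F : fieldType) (f : series I F) :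
    series I F :=
  Series (fun e =>
    \sum_(n < (\sum_i e i).+1) (n`!%:R)^-1 * coef (f ^+ n) e).

Section Deformation.
Variables (I : finType) (C : fieldType).
Variables (A : algebra (series I C)) (A0 : algebra C).
Local Notation J := (aug_ideal I C).

Definition special_fiber : algebra C :=
  restrict (quot_alg (adic_ideal J A 1)) (@seriesC I C).

Definition special_fiber_proj (a : A) : special_fiber := quot_proj _ a.

Definition flat_formal_deformation
    (phi : {rmorphism special_fiber -> A0}) : Prop :=
  [/\ adically_complete J (mod_of A),
      topologically_flat J (mod_of A)
    & alg_iso phi].
End Deformation.

Section Laurent.
Variable F : fieldType.
Local Notation "x %:F" := (@FracField.tofrac {poly F} x).

(** [F[q, 1/q]], as the subring of [F(q)] of the fractions [p / q^n]. *)
Definition laurent_pred : {pred {fraction {poly F}}} := fun x =>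
  `[< exists p n, x = p%:F / ('X%:F) ^+ n >].

Let X0 n : ('X%:F) ^+ n != 0 :> {fraction {poly F}}.
Proof. by rewrite expf_neq0 // tofrac_eq0 polyX_eq0. Qed.

Fact laurent_subring : subring_closed laurent_pred.
Proof.
split=> [|x y /asboolP[p [n ->]] /asboolP[r [k ->]]
         |x y /asboolP[p [n ->]] /asboolP[r [k ->]]]; apply/asboolP.
- by exists 1, 0; rewrite expr0 divr1 rmorph1.
- exists (p * 'X^k - r * 'X^n), (n + k)%N.
  rewrite rmorphB !rmorphM !rmorphXn /= exprD -[- (_ / _)]mulNr addf_div ?X0 //.
  by rewrite mulNr.
exists (p * r), (n + k)%N.
by rewrite rmorphM exprD mulf_div.
Qed.
HB.instance Definition _ :=
  GRing.isSubringClosed.Build {fraction {poly F}} laurent_pred laurent_subring.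

Record laurent :=
  Laurent { laurent_val : {fraction {poly F}}; _ : laurent_val \in laurent_pred }.
HB.instance Definition _ := [isSub for laurent_val].
HB.instance Definition _ := [Choice of laurent by <:].
HB.instance Definition _ := [SubChoice_isSubComNzRing of laurent by <:].

Fact laurent_const_proof (c : F) : (c%:P)%:F \in laurent_pred.
Proof. by apply/asboolP; exists c%:P, 0%N; rewrite expr0 divr1. Qed.
Definition laurent_const (c : F) : laurent := Laurent (laurent_const_proof c).

Fact laurent_const_zmod : zmod_morphism laurent_const.
Proof. by move=> a b; apply: val_inj; rewrite /= rmorphB /= !rmorphB. Qed.
HB.instance Definition _ :=
  GRing.isZmodMorphism.Build F laurent laurent_const laurent_const_zmod.
Fact laurent_const_monoid : monoid_morphism laurent_const.
Proof. by split=> [|a b]; apply: val_inj; rewrite /= ?rmorph1 // !rmorphM. Qed.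
HB.instance Definition _ :=
  GRing.isMonoidMorphism.Build F laurent laurent_const laurent_const_monoid.

Fact laurentX_proof : 'X%:F \in laurent_pred.
Proof. by apply/asboolP; exists 'X, 0%N; rewrite expr0 divr1. Qed.
Definition laurentX : laurent := Laurent laurentX_proof.
End Laurent.

Section FreeAlgebra.
Variables (L : comNzRingType) (X : choiceType).

Program Definition free_alg : algebra L :=
  @Algebra L {malg L[{fmonom X}]} (@malgC {fmonom X} L) _.
Next Obligation.
move=> c a.
rewrite /= !malgM_def fgmulUg fgmulgU; apply: eq_bigr => k _.
by rewrite mul1m mulm1 mulrC.
Qed.

Definition free_gen (x : X) : free_alg := << fmu x >>.
End FreeAlgebra.

Inductive star := D4 | E6 | E7 | E8.

Definition star_degrees (D : star) : seq nat :=
  match D with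
  | D4 => [:: 2; 2; 2; 2]
  | E6 => [:: 3; 3; 3]
  | E7 => [:: 2; 4; 4]
  | E8 => [:: 2; 3; 6]
  end%N.

Definition complexes (R : realType) : fieldType := R[i].

Section StarAlgebras.
Variables (R : realType) (D : star).

Local Notation m := (size (star_degrees D)).
Local Notation d k := (nth 0%N (star_degrees D) k).
Local Notation C := (complexes R).
Local Notation L := (laurent C).
Local Notation F := (free_alg L 'I_m).

Inductive B_rel : F -> Prop :=
| B_rel_power (k : 'I_m) : B_rel (free_gen L k ^+ d k - 1)
| B_rel_prod : B_rel (\prod_(k < m) free_gen L k - alg_scalar F (laurentX C)).

Definition B : algebra L := quot_alg (ideal_of B_rel).
Definition B_T (k : 'I_m) : B := quot_proj _ (free_gen L k).

(** Since [\sum_j tau_kj = 0], for each [k] the parameters other than the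
    last one are independent, and they determine the last one. *)
Definition param : finType := {k : 'I_m & 'I_(d k).-1}.
Local Notation Ctau := (series param C).
Local Notation Ltau := (series param L).

Definition indep_tau (k : 'I_m) (j : 'I_(d k).-1) : Ctau :=
  seriesX C (Tagged (fun k : 'I_m => 'I_(d k).-1) j : param).

(** Indices start at 0: [tau k j] is the parameter usually written
    [tau_(k+1, j+1)], with [0 <= j < d k]. *)
Definition tau (k : 'I_m) (j : 'I_(d k)) : Ctau :=
  if insub (j : nat) is Some i then @indep_tau k i
  else - \sum_(i < (d k).-1) indep_tau i.

Lemma star_degree_gt0 (k : 'I_m) : (0 < d k)%N.
Proof. by case: D k => -[[|[|[|[|?]]]]]. Qed.

Lemma sum_tau (k : 'I_m) : \sum_(j < d k) tau j = 0.
Proof.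
rewrite /tau; move: (@indep_tau k); case: (d k) (star_degree_gt0 k) => //= n _ x.
rewrite big_ord_recr /= insubN ?ltnn //.
apply/eqP; rewrite subr_eq0; apply/eqP/eq_bigr => i _.
by rewrite (valK i).
Qed.

(** [exp (2 pi i a / b)] *)
Definition expi_frac (a b : nat) : C :=
  let x : R := 2 * trigo.pi * a%:R / b%:R in
  Complex (trigo.cos x) (trigo.sin x).

Definition hecke_u (k : 'I_m) (j : 'I_(d k)) : Ctau :=
  seriesC _ (expi_frac j.+1 (d k)) * series_exp (tau j).

(** Series in [tau] over [L<T_1, ..., T_m>]: the [tau]-adic completion of
    [L[[tau]]<T_1, ..., T_m>]. *)
Definition Hfree : algebra Ltau := series_alg param F.
Definition Hfree_T (k : 'I_m) : Hfree := seriesC param (free_gen L k).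

Definition Hfree_u (k : 'I_m) (j : 'I_(d k)) : Hfree :=
  alg_scalar Hfree (series_map (@laurent_const C) (hecke_u j)).

Inductive H_rel : Hfree -> Prop :=
| H_rel_roots (k : 'I_m) : H_rel (\prod_(j < d k) (Hfree_T k - Hfree_u j))
| H_rel_prod :
    H_rel (\prod_(k < m) Hfree_T k - alg_scalar Hfree (seriesC _ (laurentX C))).

(** A topological presentation: the relations generate a closed ideal.  The
    topology is the same for the ideals of [tau] in [C[[tau]]] and in
    [L[[tau]]]. *)
Definition Hhat : algebra Ltau :=
  quot_alg (adic_closure (aug_ideal param L) (ideal_of H_rel)).
Definition Hhat_T (k : 'I_m) : Hhat := quot_proj _ (Hfree_T k).

Definition B_C : algebra C := restrict B (@laurent_const C).
Definition B_C_T (k : 'I_m) : B_C := to_restrict _ (B_T k).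
Definition B_C_scalar (c : L) : B_C := to_restrict _ (alg_scalar B c).

Definition Hhat_C : algebra Ctau :=
  restrict Hhat (series_map (@laurent_const C)).
Definition Hhat_C_T (k : 'I_m) : Hhat_C := to_restrict _ (Hhat_T k).
Definition Hhat_C_scalar (c : Ltau) : Hhat_C :=
  to_restrict _ (alg_scalar Hhat c).
End StarAlgebras.

(* Main.v *)
Require Import Defs.
From HB Require Import structures.
From mathcomp Require Import all_boot all_order all_algebra.
From mathcomp Require Import finmap.
From mathcomp.multinomials Require Import monalg.
From mathcomp Require Import boolp reals complex.
From mathcomp Require classical_sets trigo.
From mathcomp Require Import ring.

Set Implicit Arguments.
Unset Strict Implicit.
Unset Printing Implicit Defensive.
Import Order.TTheory GRing.Theory Num.Theory.
Local Open Scope ring_scope.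

(** The algebra given by the deformed relations is generated by lifts of
    elements of [B], as a complete module over the series in [tau], hence it
    cannot be larger than the module [B[[tau]]].  The point is that it is not
    smaller, and this is shown by representing it on a module of that size.

    For [q = 1] the algebra [B] is the group algebra of a wallpaper group,
    generated by rotations of a plane lattice.  Let [E] be the algebra of the
    [L]-linear endomorphisms of the functions from the lattice to [B], and let
    [T_k] act on such a function by its own value and by its rotation
    ([rot_op]).  Acting on the constant function [1] and evaluating at the
    origin recovers [B] from [E].  It remains to lift this action to operators
    with coefficients in [E[[tau]]] which satisfy the deformed relations
    ([deformed_generators]).

    The polynomial relations are no obstacle: [T_k] has finite order, so it is
    a combination of idempotents, and its eigenvalues can be moved to the
    [u_kj] without moving the idempotents ([deformed_root]).  These relations
    survive conjugation, so the product relation may be restored by conjugating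
    the first two operators, one degree in [tau] at a time ([deform_product]).
    Each degree asks for a solution [(Y1, Y2)] of the linear equation
    [[Y1, T_1] T_2 c + T_1 [Y2, T_2] c = X] in [E], where [c] is the product of
    the other generators.  It is solvable as soon as [Y - g Y g^-1 = X] is,
    where [g] is the commutator of [T_1] and [T_2]
    ([linearized_product_surj]).  This [g] translates the lattice, so it has
    infinite order, and the formal solution [X + g X g^-1 + g^2 X g^-2 + ...]
    can be cut to a finite sum at each point ([adjoint_surj]).  In other words,
    the second cohomology of an infinite plane group with coinduced
    coefficients vanishes.

    The representation gives a linear map [normal_form] from the deformed
    algebra to [B[[tau]]] whose lowest coefficients are the reductions modulo
    [tau]; successive approximation shows that it is bijective.  Completeness
    and flatness are then properties of [B[[tau]]]; the second holds because
    [B] is a vector space over the complex numbers ([flat_criterion]). *)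

(** * Power series and their order *)

Section Degree.
Variable I : finType.
Implicit Types d e : {ffun I -> nat}.

Definition deg e : nat := (\sum_i e i)%N.

Lemma degD d e : deg (d + e) = (deg d + deg e)%N.
Proof. by rewrite /deg -big_split; apply: eq_bigr => i _; rewrite ffunE. Qed.

Lemma deg0 : deg 0 = 0%N.
Proof. by rewrite /deg big1 // => i _; rewrite ffunE. Qed.

Lemma expo_subDK e d : d \in below e -> (d + expo_sub e d)%R = e.
Proof. by move=> /belowP de; apply/ffunP => i; rewrite !ffunE; apply: subnKC. Qed.

Lemma deg_sub e d : d \in below e -> (deg d + deg (expo_sub e d))%N = deg e.
Proof. by move=> de; rewrite -degD expo_subDK. Qed.

Lemma deg_eq0 e : (deg e == 0%N) = (e == 0).
Proof.
rewrite /deg sum_nat_eq0; apply/forallP/eqP => [e0|-> i]; last by rewrite ffunE.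
by apply/ffunP => i; rewrite ffunE; apply/eqP; have := e0 i.
Qed.

Lemma below_refl e : e \in below e.
Proof. exact/belowP. Qed.

Lemma deg_below_lt e d : d \in below e -> d != e -> (deg d < deg e)%N.
Proof.
move=> de d_e; rewrite -(deg_sub de) -[X in (X < _)%N]addn0 ltn_add2l lt0n deg_eq0.
by apply: contra d_e => /eqP s0; rewrite -(expo_subDK de) s0 addr0.
Qed.

Lemma expo_subDl d e : expo_sub (d + e) d = e.
Proof. by apply/ffunP => i; rewrite !ffunE addKn. Qed.

Lemma below_addl d e : d \in below (d + e).
Proof. by apply/belowP => i; rewrite ffunE leq_addr. Qed.

(** A box of exponents: a finite set that contains all those of degree at
    most [n], over which truncated series can be summed. *)
Definition expos n : seq {ffun I -> nat} := below [ffun=> n].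

Lemma expos_uniq n : uniq (expos n).
Proof. exact: below_uniq. Qed.

Lemma mem_expos n e : (deg e <= n)%N -> e \in expos n.
Proof.
move=> en; apply/belowP => i; rewrite ffunE; apply: leq_trans en.
by rewrite /deg (bigD1 i) //= leq_addr.
Qed.
End Degree.

Section Order.
Variables (I : finType) (A : pzRingType).
Implicit Types (f g : series I A) (d e : {ffun I -> nat}) (a b : A).

(** All convergence arguments are carried out with these ideals, which are
    later identified with the powers of the ideal of the variables. *)
Definition ord_ge (n : nat) : {pred series I A} := fun f =>
  `[< forall e, (deg e < n)%N -> coef f e = 0 >].

Lemma ord_geP n f :
  reflect (forall e, (deg e < n)%N -> coef f e = 0) (f \in ord_ge n).
Proof. exact: asboolP. Qed.

Fact ord_ge_zmod n : zmod_closed (ord_ge n).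
Proof.
split=> [|f g /ord_geP hf /ord_geP hg]; apply/ord_geP => e en //=.
by rewrite hf // hg // subrr.
Qed.
HB.instance Definition _ n :=
  GRing.isZmodClosed.Build (series I A) (ord_ge n) (ord_ge_zmod n).

Lemma ord_geM m n f g :
  f \in ord_ge m -> g \in ord_ge n -> f * g \in ord_ge (m + n).
Proof.
move=> /ord_geP hf /ord_geP hg; apply/ord_geP => e en /=.
rewrite big1_seq // => d /andP[_ de]; case: (ltnP (deg d) m) => dm.
  by rewrite hf // mul0r.
rewrite hg ?mulr0 // -(ltn_add2l (deg d)) deg_sub //.
by apply: leq_trans en _; rewrite leq_add2r.
Qed.

Lemma ord_ge0 f : f \in ord_ge 0.
Proof. exact/ord_geP. Qed.

Lemma ord_ge_le m n f : (m <= n)%N -> f \in ord_ge n -> f \in ord_ge m.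
Proof.
by move=> mn /ord_geP hf; apply/ord_geP => e em; apply/hf/(leq_trans em).
Qed.

Fact ord_ge_mulL n f : {in ord_ge n, forall g, f * g \in ord_ge n}.
Proof. by move=> g hg; rewrite -[n]add0n ord_geM ?ord_ge0. Qed.
Fact ord_ge_mulR n f : {in ord_ge n, forall g, g * f \in ord_ge n}.
Proof. by move=> g hg; rewrite -[n]addn0 ord_geM ?ord_ge0. Qed.
HB.instance Definition _ n :=
  isTwoSided.Build (series I A) (ord_ge n) (@ord_ge_mulL n) (@ord_ge_mulR n).

Lemma ord_ge_eq0 f : (forall n, f \in ord_ge n) -> f = 0.
Proof. by move=> hf; apply/seriesP => e; apply: (ord_geP _ _ (hf (deg e).+1)). Qed.

Lemma ord_ge_eq f g : (forall n, f - g \in ord_ge n) -> f = g.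
Proof. by move=> fg; apply/eqP; rewrite -subr_eq0; apply/eqP/ord_ge_eq0. Qed.

Lemma ord_ge1 f : (f \in ord_ge 1) = (coef f 0 == 0).
Proof.
apply/ord_geP/eqP => [-> //|f0 e]; first by rewrite deg0.
by rewrite ltnS leqn0 deg_eq0 => /eqP->.
Qed.

Lemma ord_geS n f : f \in ord_ge n ->
  (forall e, deg e = n -> coef f e = 0) -> f \in ord_ge n.+1.
Proof.
move=> /ord_geP hf fn; apply/ord_geP => e.
by rewrite ltnS leq_eqVlt => /orP[/eqP/fn|/hf].
Qed.

(** These give the linear part of an equation in degree [n]: all the other terms
    of the convolution involve a coefficient of degree less than [n] of the
    factor of order [n]. *)
Lemma coefM_leadl n f g e : f \in ord_ge n -> deg e = n ->
  coef (f * g) e = coef f e * coef g 0.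
Proof.
move=> /ord_geP hf en /=; rewrite (bigD1_seq e) ?below_uniq ?below_refl //=.
rewrite big1_seq ?addr0 => [|d /andP[de dbe]]; last first.
  by rewrite hf ?mul0r // -en deg_below_lt.
by congr (_ * coef g _); apply/ffunP => i; rewrite !ffunE subnn.
Qed.

Lemma coefM_leadr n f g e : g \in ord_ge n -> deg e = n ->
  coef (f * g) e = coef f 0 * coef g e.
Proof.
move=> /ord_geP hg en /=; rewrite (bigD1_seq 0) ?below_uniq ?below0 //=.
rewrite big1_seq ?addr0 ?expo_sub0 // => d /andP[d0 dbe].
rewrite hg ?mulr0 // -en -(deg_sub dbe) -[X in (X < _)%N]add0n ltn_add2r.
by rewrite lt0n deg_eq0.
Qed.

Lemma series_coef0M f g : coef (f * g) 0 = coef f 0 * coef g 0.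
Proof. by rewrite (@coefM_leadl 0) ?ord_ge0 ?deg0. Qed.

Definition coef_at e f : A := coef f e.
Fact coef_at_zmod e : zmod_morphism (coef_at e). Proof. by []. Qed.
HB.instance Definition _ e :=
  GRing.isZmodMorphism.Build (series I A) A (coef_at e) (coef_at_zmod e).

Definition const_coef f : A := coef f 0.
Fact const_coef_zmod : zmod_morphism const_coef. Proof. by []. Qed.
HB.instance Definition _ :=
  GRing.isZmodMorphism.Build (series I A) A const_coef const_coef_zmod.
Fact const_coef_monoid : monoid_morphism const_coef.
Proof. by split=> [|f g]; [rewrite /const_coef /= eqxx | apply: series_coef0M]. Qed.
HB.instance Definition _ :=
  GRing.isMonoidMorphism.Build (series I A) A const_coef const_coef_monoid.

Lemma series_coef_sum (T : Type) (r : seq T) (P : pred T) (F : T -> series I A) e :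
  coef (\sum_(i <- r | P i) F i) e = \sum_(i <- r | P i) coef (F i) e.
Proof. exact: (raddf_sum (coef_at e)). Qed.

Definition mono d a : series I A := Series (fun e => if e == d then a else 0).

Lemma mono0 a : mono 0 a = seriesC I a.
Proof. by []. Qed.

Lemma monoM d e a b : mono d a * mono e b = mono (d + e) (a * b).
Proof.
apply/seriesP => c /=; case: eqP => [->|ce].
  rewrite (bigD1_seq d) ?below_uniq ?below_addl //= eqxx expo_subDl eqxx.
  by rewrite big1 ?addr0 // => i /negPf->; rewrite mul0r.
rewrite big1_seq // => i /andP[_ ic].
case: eqP => [id|_]; last by rewrite mul0r.
by case: eqP => [ie|_]; rewrite ?mulr0 //; case: ce; rewrite -id -ie expo_subDK.
Qed.

Lemma mono1_comm d f : mono d 1 * f = f * mono d 1.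
Proof.
by apply: series_mul_comm => b e /=; case: ifP; rewrite ?mul1r ?mulr1 ?mul0r ?mulr0.
Qed.

Lemma ord_ge_mono d a n : (n <= deg d)%N -> mono d a \in ord_ge n.
Proof.
move=> nd; apply/ord_geP => e en /=; case: eqP => // ed.
by move: en; rewrite ed ltnNge nd.
Qed.

(** The cut is made along the box [expos n], so that some terms of degree [n]
    and more survive. *)
Definition trunc n f := \sum_(d <- expos I n) mono d (coef f d).

Lemma coef_trunc n f e : e \in expos I n -> coef (trunc n f) e = coef f e.
Proof.
move=> en; rewrite series_coef_sum (bigD1_seq e) ?expos_uniq //= eqxx big1 ?addr0 //.
by move=> d; rewrite eq_sym => /negPf->.
Qed.

Lemma trunc_ord n f : f - trunc n f \in ord_ge n.
Proof.
apply/ord_geP => e en.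
rewrite -[coef _ e]/(coef f e - coef (trunc n f) e).
by rewrite coef_trunc ?subrr // mem_expos // ltnW.
Qed.

(** The coefficient of degree [k] does not change after the step [k.+1]. *)
Lemma ord_ge_cauchy (u : nat -> series I A) :
  (forall n, u n.+1 - u n \in ord_ge n) ->
  exists v, forall n, v - u n \in ord_ge n.
Proof.
move=> hu; have huk m k : u (m + k)%N - u m \in ord_ge m.
  elim: k => [|k IH]; first by rewrite addn0 subrr rpred0.
  rewrite addnS -(subrK (u (m + k)%N) (u _.+1)) -addrA rpredD //.
  by apply: ord_ge_le (hu _); apply: leq_addr.
exists (Series (fun e => coef (u (deg e).+1) e)) => n; apply/ord_geP => e en /=.
have /ord_geP/(_ e (ltnSn _)) := huk (deg e).+1 (n - (deg e).+1)%N.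
by rewrite subnKC //= => /eqP; rewrite subr_eq0 => /eqP->; rewrite subrr.
Qed.

(** The inverse is the geometric series in [- y]. *)
Lemma ord_ge_inv n (y : series I A) : (0 < n)%N -> y \in ord_ge n ->
  exists z, [/\ (1 + y) * z = 1, z * (1 + y) = 1 & z - 1 \in ord_ge n].
Proof.
move=> n0 hy; pose x := - y; have hx : x \in ord_ge 1.
  by rewrite rpredN; apply: ord_ge_le hy.
have hxk k : x ^+ k \in ord_ge k.
  elim: k => [|k IH]; first exact: ord_ge0.
  by rewrite exprS -add1n ord_geM.
pose u k := \sum_(i < k) x ^+ i.
have [|z hz] := @ord_ge_cauchy u.
  by move=> k; rewrite /u big_ord_recr /= addrAC subrr add0r.
have uE k : (1 + y) * u k = 1 - x ^+ k.
  by rewrite -[1 - _]opprB subrX1 -/(u k) -mulNr opprB opprK.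
have uC k : u k * (1 + y) = (1 + y) * u k.
  apply: esym; rewrite /u mulr_sumr mulr_suml; apply: eq_bigr => i _.
  have -> : 1 + y = 1 - x by rewrite /x opprK.
  by rewrite mulrBl mulrBr mul1r mulr1 -exprS exprSr.
have zl : (1 + y) * z = 1.
  apply: ord_ge_eq => k.
  have -> : (1 + y) * z - 1 = (1 + y) * (z - u k) - x ^+ k.
    by rewrite mulrBr uE opprB addrA addrAC addrK.
  by rewrite rpredB // ideal_mulL.
have zr : z * (1 + y) = 1.
  apply: ord_ge_eq => k.
  have -> : z * (1 + y) - 1 = (z - u k) * (1 + y) - x ^+ k.
    by rewrite mulrBl uC uE opprB addrA addrAC addrK.
  by rewrite rpredB // ideal_mulR.
exists z; split => //.
have -> : z - 1 = - (y * z) by rewrite -zl mulrDl mul1r opprD addrA subrr add0r.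
by rewrite rpredN ideal_mulR.
Qed.
End Order.
Arguments ord_ge {I A} n.
Arguments const_coef {I A} f.
Arguments coef_at {I A} e f.
Arguments mono {I A} d a.


(** * Flatness from coordinate functionals *)

Section Functional.
Import classical_sets.
Local Open Scope classical_set_scope.
Variables (C : fieldType) (V : lmodType C).

Definition inspan (t : seq V) (v : V) : Prop :=
  exists c : nat -> C, v = \sum_(i < size t) c i *: t`_i.

Lemma inspan_lin t a u v :
  inspan t u -> inspan t v -> inspan t (a *: u + v).
Proof.
move=> [c ->] [d ->]; exists (fun i => a * c i + d i).
rewrite scaler_sumr -big_split; apply: eq_bigr => i _ /=.
by rewrite scalerDl scalerA.
Qed.

Lemma inspan_mem t v : v \in t -> inspan t v.
Proof.
move=> vt; have it : (index v t < size t)%N by rewrite index_mem.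
exists (fun i => (i == index v t)%:R).
rewrite (bigD1 (Ordinal it)) //= eqxx scale1r nth_index // big1 ?addr0 //.
by move=> i /negPf; rewrite -val_eqE /= => ->; rewrite scale0r.
Qed.

(** A subspace maximal among those that contain [t] but not [v] has
    codimension one, so it is the kernel of the wanted functional. *)
Lemma functional_exists t v : ~ inspan t v ->
  exists l : V -> C, [/\ forall a x y, l (a *: x + y) = a * l x + l y, l v = 1
    & forall w, w \in t -> l w = 0].
Proof.
move=> tv; pose good (H : set V) := [/\ forall x, inspan t x -> H x,
  forall a x y, H x -> H y -> H (a *: x + y) & ~ H v].
have good_t : good (inspan t) by split=> // a x y; apply: inspan_lin.
have inspan0 : inspan t 0.
  by exists (fun=> 0); rewrite big1 // => i _; rewrite scale0r.
(* The empty set is admitted because it is the union of the empty chain. *)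
have [|A [PA maxA]] := @Zorn_bigcup V (fun H => H = set0 \/ good H).
  move=> F FP totF; case: (pselect (exists2 H, F H & good H)) => [[H0 FH0 gH0]|nF].
    right; split=> [x tx|a x y [H1 FH1 H1x] [H2 FH2 H2y]|[H FH Hv]].
    - by exists H0 => //; case: gH0 => /(_ x tx).
    - have ex : exists H, [/\ F H, H x & H y].
        by case: (totF _ _ FH1 FH2) => [/(_ _ H1x)|/(_ _ H2y)] ?;
          [exists H2|exists H1].
      case: ex => H [FH Hx Hy]; exists H => //.
      by case: (FP _ FH) Hx => [->//|[_ cl _] Hx]; apply: cl.
    by case: (FP _ FH) Hv => [->//|[_ _ nv] /nv].
  left; rewrite -subset0 => x [H FH Hx]; case: (FP _ FH) => [H0|gH].
    by rewrite H0 in Hx.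
  by case: nF; exists H.
have gA : good A.
  case: PA => [A0|//]; case: (maxA (inspan t)); last by right.
  by rewrite A0; split=> [x //|/(_ _ inspan0)].
case: gA => At Alin Av; have A0 := At _ inspan0.
have coord x : exists c, A (x - c *: v).
  case: (pselect (A x)) => [Ax|nAx]; first by exists 0; rewrite scale0r subr0.
  pose B : set V := fun y => exists a, A (y - a *: x).
  have AB : A `<` B.
    split=> [y Ay|/(_ x)]; first by exists 0; rewrite scale0r subr0.
    by move/contra_not; apply=> //; exists 1; rewrite scale1r subrr.
  have /contrapT[a Aa] : ~ ~ B v.
    move=> nBv; case: (maxA B AB); right; split=> //.
      by move=> y /At Ay; exists 0; rewrite scale0r subr0.
    move=> a y z [b Ay] [c Az]; exists (a * b + c).
    have -> : a *: y + z - (a * b + c) *: x = a *: (y - b *: x) + (z - c *: x).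
      by rewrite scalerDl scalerBr scalerA opprD addrACA.
    exact: Alin.
  have a0 : a != 0 by apply/eqP => a0; apply: Av; rewrite a0 scale0r subr0 in Aa.
  exists a^-1; have -> : x - a^-1 *: v = - a^-1 *: (v - a *: x) + 0.
    by rewrite addr0 scalerBr !scaleNr scalerA mulVf // scale1r opprK addrC.
  exact: Alin.
have uniq x c d : A (x - c *: v) -> A (x - d *: v) -> c = d.
  move=> Ac Ad; apply/eqP; rewrite -subr_eq0; case: eqP => // /eqP cd; case: Av.
  have -> : v = (c - d)^-1 *: (-1 *: (x - c *: v) + (x - d *: v)) + 0.
    rewrite addr0 scaleN1r opprB addrA subrK -scalerBl scalerA mulVf // scale1r //.
  exact/Alin/A0/Alin.
pose l x := sval (cid (coord x)).
have lP x : A (x - l x *: v) by rewrite /l; case: cid.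
have lE x c : A (x - c *: v) -> l x = c by apply: uniq.
exists l; split=> [a x y||w wt]; apply: lE.
- have -> : a *: x + y - (a * l x + l y) *: v
      = a *: (x - l x *: v) + (y - l y *: v).
    by rewrite scalerDl scalerBr scalerA opprD addrACA.
  exact: Alin.
- by rewrite scale1r subrr.
by rewrite scale0r subr0; apply/At/inspan_mem.
Qed.
End Functional.

(** The hypotheses say that [V] behaves like the extension of scalars of the
    vector space [V0] to [K]: it is generated by [V0], and every functional on
    [V0] extends to it. *)
Section FlatCriterion.
Variables (C : fieldType) (K : comPzRingType) (iota : {rmorphism C -> K}).
Variables (V0 : lmodType C) (V : lmodType K) (j : V0 -> V).
Hypothesis jlin : forall c u v, j (c *: u + v) = iota c *: j u + j v.
Hypothesis jgen : forall x : V, exists s : seq (K * V0),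
  x = \sum_(y <- s) y.1 *: j y.2.
Hypothesis jdual : forall l : V0 -> C,
  (forall a x y, l (a *: x + y) = a * l x + l y) ->
  exists2 l' : V -> K, (forall a x y, l' (a *: x + y) = a * l' x + l' y)
    & forall v, l' (j v) = iota (l v).

Section Bilinear.
Variables (M P : lmodType K) (b : M -> V -> P).
Hypothesis hb : bilinear_map b.

Lemma bilinear0r m : b m 0 = 0.
Proof. by have := hb.2 m (-1) 0 0; rewrite scaler0 addr0 scaleN1r addNr. Qed.
Lemma bilinear0l x : b 0 x = 0.
Proof. by have := hb.1 x (-1) 0 0; rewrite scaler0 addr0 scaleN1r addNr. Qed.
Lemma bilinearDl x m n : b (m + n) x = b m x + b n x.
Proof. by have := hb.1 x 1 m n; rewrite !scale1r. Qed.
Lemma bilinearDr m x y : b m (x + y) = b m x + b m y.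
Proof. by have := hb.2 m 1 x y; rewrite !scale1r. Qed.
Lemma bilinearZl a m x : b (a *: m) x = a *: b m x.
Proof. by have := hb.1 x a m 0; rewrite !addr0 bilinear0l addr0. Qed.
Lemma bilinearZr a m x : b m (a *: x) = a *: b m x.
Proof. by have := hb.2 m a x 0; rewrite !addr0 bilinear0r addr0. Qed.
Lemma bilinear_sumr m (T : Type) (r : seq T) (F : T -> V) :
  b m (\sum_(i <- r) F i) = \sum_(i <- r) b m (F i).
Proof.
by elim: r => [|i r IH]; rewrite ?big_nil ?bilinear0r // !big_cons bilinearDr IH.
Qed.
End Bilinear.

Lemma j0 : j 0 = 0.
Proof.
by have := jlin (-1) 0 0; rewrite scaler0 addr0 rmorphN1 scaleN1r addNr.
Qed.
Lemma jD u v : j (u + v) = j u + j v.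
Proof. by have := jlin 1 u v; rewrite rmorph1 !scale1r. Qed.
Lemma jZ c u : j (c *: u) = iota c *: j u.
Proof. by have := jlin c u 0; rewrite !addr0 j0 addr0. Qed.
Lemma j_sum (T : Type) (r : seq T) (F : T -> V0) :
  j (\sum_(i <- r) F i) = \sum_(i <- r) j (F i).
Proof. by elim: r => [|i r IH]; rewrite ?big_nil ?j0 // !big_cons jD IH. Qed.

(** The list [s'] does not depend on the maps [f] and [b], so that the same
    rewriting applies to a tensor and to its image. *)
Lemma tensor_gen (M : lmodType K) (s : seq (M * V)) :
  exists s' : seq (M * V0),
  forall (M' P : lmodType K) (f : {linear M -> M'}) (b : M' -> V -> P),
  bilinear_map b ->
  \sum_(x <- s) b (f x.1) x.2 = \sum_(x <- s') b (f x.1) (j x.2).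
Proof.
elim: s => [|[m x] s [s' IH]]; first by exists [::] => *; rewrite !big_nil.
have [t ->] := jgen x; exists ([seq (y.1 *: m, y.2) | y <- t] ++ s').
move=> M' P f b hb; rewrite big_cons big_cat IH //= big_map bilinear_sumr //.
congr (_ + _); apply: eq_bigr => y _ /=.
by rewrite bilinearZr // linearZ /= bilinearZl.
Qed.

(** Flatness is proved by shortening a vanishing tensor: if one second factor
    depends on the others it can be eliminated; otherwise the functional that
    isolates it shows that its partner is mapped to [0]. *)
Lemma flat_criterion : flat V.
Proof.
move=> M M' f f_inj s s0 P b hb; have [s' hs'] := tensor_gen s.
have := hs' M P idfun b hb; rewrite /= => ->.
have {s0}: forall (P : lmodType K) (b : M' -> V -> P), bilinear_map b ->
    \sum_(x <- s') b (f x.1) (j x.2) = 0.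
  by move=> P' b' hb'; have := s0 P' b' hb'; rewrite -(hs' M') // big_map.
clear s hs'; have [n le_n] := ubnP (size s').
elim: n => // n IH in s' le_n *; case: s' le_n => [|[m v] t] /= le_n s0.
  by rewrite big_nil.
case: (pselect (inspan [seq x.2 | x <- t] v)) => [[c cv]|nv].
  pose t' := mkseq (fun i => ((nth (0, 0) t i).1 + iota (c i) *: m,
                              (nth (0, 0) t i).2)) (size t).
  have tt' (N Q : lmodType K) (g : {linear M -> N}) (h : N -> V -> Q) :
    bilinear_map h -> \sum_(x <- (m, v) :: t) h (g x.1) (j x.2)
      = \sum_(x <- t') h (g x.1) (j x.2).
    move=> hh; rewrite big_cons /= cv j_sum bilinear_sumr // size_map.
    rewrite (big_nth (0, 0)) big_mkord -big_split big_map.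
    have -> G : \sum_(i <- seq.iota 0 (size t)) G i = \sum_(i < size t) G i :> Q.
      by rewrite -(big_mkord xpredT G) /index_iota subn0.
    apply: eq_bigr => i _ /=.
    rewrite (nth_map (0, 0)) // jZ bilinearZr // linearD linearZ /=.
    by rewrite bilinearDl // bilinearZl // addrC.
  have := tt' M P idfun b hb; rewrite /= => ->; apply: IH.
    by rewrite size_mkseq.
  by move=> Q h hh; rewrite -(tt' M') // s0.
have [l [llin lv lt]] := functional_exists nv; have [l' l'lin l'j] := jdual llin.
have m0 : m = 0.
  apply: f_inj; have bl : bilinear_map (fun (m' : M') x => l' x *: m').
    split=> [x a u w|u a x y] /=; first by rewrite scalerDr !scalerA mulrC.
    by rewrite l'lin scalerDl scalerA.
  have := s0 _ _ bl; rewrite big_cons /= l'j lv rmorph1 scale1r linear0.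
  rewrite big1_seq ?addr0 // => x /andP[_ xt].
  by rewrite l'j lt ?rmorph0 ?scale0r // map_f.
rewrite big_cons m0 bilinear0l // add0r; apply: IH => // Q h hh.
by have := s0 Q h hh; rewrite big_cons m0 linear0 bilinear0l // add0r.
Qed.
End FlatCriterion.


(** * Modules isomorphic to power series over an algebra *)

Section SeriesAdic.
Variables (I : finType) (K : comPzRingType) (A : algebra K).
Local Notation J := (aug_ideal I K).
Local Notation S := (mod_of (series_alg I A)).

Lemma series_map_ord (B B' : pzRingType) (f : {rmorphism B -> B'}) n
    (r : series I B) : r \in ord_ge n -> series_map f r \in ord_ge n.
Proof. by move=> /ord_geP hr; apply/ord_geP => e en /=; rewrite hr ?rmorph0. Qed.

Lemma aug_idealE (r : series I K) : (r \in J) = (r \in ord_ge 1).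
Proof. by rewrite ord_ge1. Qed.

Lemma coef_mono1M d e (f : series I A) :
  coef (mono d 1 * f) e = if d \in below e then coef f (expo_sub e d) else 0.
Proof.
rewrite /=; case: ifP => de.
  rewrite (bigD1_seq d) ?below_uniq //= eqxx mul1r big1 ?addr0 // => c.
  by move=> /negPf->; rewrite mul0r.
rewrite big1_seq // => c /andP[_ ce]; case: eqP => [cd|_]; rewrite ?mul0r //.
by rewrite -cd ce in de.
Qed.

Definition expo1 (i : I) : {ffun I -> nat} := [ffun k => (k == i) : nat].

Lemma deg_expo1 i : deg (expo1 i) = 1%N.
Proof.
rewrite /deg (bigD1 i) //= ffunE eqxx big1 // => k.
by rewrite ffunE => /negPf->.
Qed.

Lemma series_mapX i : series_map (alg_scalar A) (seriesX K i) = mono (expo1 i) 1.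
Proof.
by apply/seriesP => e /=; case: eqP => _; rewrite ?rmorph1 ?rmorph0.
Qed.

Lemma below_expo1 i e : (expo1 i \in below e) = (0 < e i)%N.
Proof.
apply/belowP/idP => [/(_ i)|ei k]; rewrite ffunE ?eqxx //.
by case: eqP => // ->.
Qed.

(** A series without constant term is a combination of the variables: each
    monomial is assigned to one variable that divides it. *)
Lemma ord_ge_decomp (f : series I A) n : f \in ord_ge n.+1 ->
  exists2 g : I -> series I A, (forall i, g i \in ord_ge n)
    & f = \sum_i mono (expo1 i) 1 * g i.
Proof.
move=> /ord_geP hf; pose pk (e : {ffun I -> nat}) := [pick i | 0 < e i]%N.
exists (fun i => Series (fun e =>
  if pk (e + expo1 i) == Some i then coef f (e + expo1 i) else 0)).
  move=> i; apply/ord_geP => e en /=; case: ifP => // _; apply: hf.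
  by rewrite degD deg_expo1 addn1 ltnS.
apply/seriesP => e; rewrite series_coef_sum.
under eq_bigr do rewrite coef_mono1M below_expo1 /=.
have subK i : (0 < e i)%N -> expo_sub e (expo1 i) + expo1 i = e.
  by move=> ei; rewrite addrC expo_subDK // below_expo1.
case pkE : (pk e) => [i|].
  have ei : (0 < e i)%N by move: pkE; rewrite /pk; case: pickP => // k ? [<-].
  rewrite (bigD1 i) //= ei subK // pkE eqxx big1 ?addr0 // => k ki.
  case: ifP => // ek; rewrite subK // pkE.
  by case: eqP => // -[ik]; rewrite ik eqxx in ki.
rewrite big1 => [|i _].
  apply: hf; move: pkE; rewrite /pk; case: pickP => // e0 _.
  suff -> : e = 0 by rewrite deg0.
  by apply/ffunP => i; rewrite ffunE; apply/eqP; rewrite -leqn0 leqNgt e0.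
by case: ifP => // ei; rewrite subK // pkE.
Qed.

(** A series of order [n.+1] lies in [J^n.+1] by [ord_ge_decomp], which takes out
    one variable at a time. *)
Lemma adic_series n (f : S) : (f \in adic J n) = ((f : series I A) \in ord_ge n).
Proof.
apply/idP/idP.
  move/asboolP; elim=> {n f} [f|n|n r v w Jr _ IHv _ IHw].
  - exact: ord_ge0.
  - exact: rpred0.
  rewrite aug_idealE in Jr; apply: (rpredD _ IHw).
  by rewrite -add1n; apply: ord_geM => //; apply: series_map_ord.
elim: n f => [|n IH] f hf; first by apply/asboolP/adicP_all.
have [g hg fE] := ord_ge_decomp hf.
have -> : f = \sum_i seriesX K i *: (g i : S).
  rewrite [LHS]fE; apply: eq_bigr => i _.
  by rewrite -series_mapX.
apply: rpred_sum => i _; apply/asboolP; rewrite -[_ *: _]addr0.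
apply: adicP_add (adicP_zero _ _ _) => //; last by apply/asboolP/IH.
by apply/eqP => /=; case: eqP => // /ffunP/(_ i); rewrite !ffunE eqxx.
Qed.

Lemma adic_lin (V V' : lmodType (series I K)) (f : V -> V') n v :
  linear f -> v \in adic J n -> f v \in adic J n.
Proof.
move=> flin /asboolP hv; apply/asboolP.
have f0 : f 0 = 0 by have := flin (-1) 0 0; rewrite scaler0 addr0 scaleN1r addNr.
elim: {n v} hv => [v|n|n r v w Jr _ IHv _ IHw].
- exact: adicP_all.
- by rewrite f0; apply: adicP_zero.
by rewrite flin; apply: adicP_add.
Qed.

End SeriesAdic.

Section SeriesModule.
Variables (I : finType) (C : fieldType) (A0 : algebra C).
Local Notation K := (series I C).
Local Notation J := (aug_ideal I C).
Local Notation S := (mod_of (series_alg I A0)).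
Variables (V : lmodType K) (psi : V -> S).
Hypothesis psi_lin : linear psi.
Hypothesis psi_bij : bijective psi.

Let psi0 : psi 0 = 0.
Proof. by have := psi_lin (-1) 0 0; rewrite scaler0 addr0 scaleN1r addNr. Qed.
Let psiD u v : psi (u + v) = psi u + psi v.
Proof. by have := psi_lin 1 u v; rewrite !scale1r. Qed.
Let psiN u : psi (- u) = - psi u.
Proof. by have := psi_lin (-1) u 0; rewrite !addr0 !scaleN1r psi0 addr0. Qed.

Lemma adic_psi n v : (v \in adic J n) = ((psi v : series I A0) \in ord_ge n).
Proof.
rewrite -adic_series; apply/idP/idP; first exact: adic_lin.
have [phi psiK phiK] := psi_bij; move=> hv; rewrite -(psiK v).
apply: adic_lin hv => a x y; apply: (bij_inj psi_bij).
by rewrite psi_lin !phiK.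
Qed.

Lemma series_module_complete : adically_complete J V.
Proof.
have [phi psiK phiK] := psi_bij; split=> [v hv|u hu].
  apply: (bij_inj psi_bij); rewrite psi0.
  by apply: (@ord_ge_eq0 I A0) => n; rewrite -adic_psi.
have [|w hw] := @ord_ge_cauchy I A0 (fun n => psi (u n)).
  by move=> n; have := hu n; rewrite adic_psi psiD psiN.
by exists (phi w) => n; rewrite adic_psi psiD psiN phiK.
Qed.

(** The functionals on [A0], applied to each coefficient of a series, provide
    the functionals required by the flatness criterion. *)
Lemma series_module_flat : topologically_flat J V.
Proof.
have [phi psiK phiK] := psi_bij; move=> n.
have phi_lin : linear phi.
  by move=> a x y; apply: (bij_inj psi_bij); rewrite psi_lin !phiK.
have phiD x y : phi (x + y) = phi x + phi y.
  by have := phi_lin 1 x y; rewrite !scale1r.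
have phiZ a x : phi (a *: x) = a *: phi x.
  by have := phi_lin a x 0; rewrite -psi0 psiK psi0 !addr0.
pose Kn := quot_ring (ideal_pow J n).
pose iota : C -> Kn := @quot_proj _ (ideal_pow J n) \o @seriesC I C.
pose j (v : mod_of A0) : adic_quot J V n := adic_proj J n (phi (seriesC I (v : A0))).
apply: (@flat_criterion C Kn iota (mod_of A0) _ j).
- move=> c u v; rewrite /j.
  have -> : seriesC I (c *: u + v : A0) =
      (seriesC I c *: (seriesC I (u : A0) : S) + (seriesC I (v : A0) : S)) :> S.
    rewrite rmorphD rmorphM; congr (_ * _ + _).
    by apply/seriesP => e /=; case: ifP; rewrite ?rmorph0.
  by rewrite phi_lin raddfD /= -adic_scaleE.
- move=> x; rewrite -[x]adic_liftK; set v := adic_lift x.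
  pose s := [seq (quot_proj (ideal_pow J n) (mono d 1), (coef (psi v) d : mod_of A0))
            | d <- expos I n]; exists s.
  have -> : adic_proj J n v = adic_proj J n (phi (trunc n (psi v))).
    apply/adic_proj_eq; rewrite adic_psi psiD psiN phiK.
    exact: (@trunc_ord I A0).
  have phi_sum (r : seq {ffun I -> nat}) (F : {ffun I -> nat} -> S) :
      phi (\sum_(d <- r) F d) = \sum_(d <- r) phi (F d).
    elim: r => [|d r IH]; last by rewrite !big_cons phiD IH.
    by rewrite !big_nil; apply: (bij_inj psi_bij); rewrite phiK psi0.
  rewrite /trunc [X in phi X](_ : _ = \sum_(d <- expos I n)
     (mono d 1 : K) *: (seriesC I (coef (psi v) d) : S)).
    rewrite phi_sum raddf_sum /s [RHS]big_map; apply: eq_bigr => d _ /=.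
    by rewrite /j phiZ -adic_scaleE.
  apply: eq_bigr => d _; rewrite -[RHS]/(series_map _ _ * _) -mono0.
  have -> : series_map (alg_scalar A0) (mono d 1) = mono d 1.
    by apply/seriesP => e /=; case: eqP => _; rewrite ?rmorph1 ?rmorph0.
  by rewrite monoM mul1r addr0.
move=> l llin.
have l0 : l 0 = 0.
  by have := llin (-1) 0 0; rewrite scaler0 addr0 mulN1r addNr.
have lD u v : l (u + v) = l u + l v by have := llin 1 u v; rewrite scale1r mul1r.
have lZ c u : l (c *: u) = c * l u by have := llin c u 0; rewrite !addr0 l0 addr0.
pose ls (f : S) : K := Series (fun e => l (coef f e)).
have ls_lin : linear (ls : S -> K^o).
  move=> a f g; apply/seriesP => e /=; rewrite lD; congr (_ + _).
  have lsum (r : seq {ffun I -> nat}) (F : {ffun I -> nat} -> A0) :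
      l (\sum_(d <- r) F d) = \sum_(d <- r) l (F d).
    by elim: r => [|d r IH]; rewrite ?big_nil // !big_cons lD IH.
  by rewrite lsum; apply: eq_bigr => d _; apply: lZ.
pose l' (x : adic_quot J V n) : Kn := quot_proj _ (ls (psi (adic_lift x))).
have l'E v : l' (adic_proj J n v) = quot_proj _ (ls (psi v)).
  apply/quot_proj_eq.
  have -> : ls (psi (adic_lift (adic_proj J n v))) - ls (psi v)
     = ls (psi (adic_lift (adic_proj J n v) - v)).
    by rewrite psiD psiN; apply/seriesP => e /=; rewrite lD -mulN1r -lZ scaleN1r.
  apply: (@adic_lin _ _ V K^o (ls \o psi)).
    by move=> a x y /=; rewrite psi_lin ls_lin.
  by apply/adic_proj_eq; rewrite adic_liftK.
exists l' => [a x y|v].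
  rewrite -[a]quot_liftK -[x]adic_liftK -[y]adic_liftK.
  have -> : quot_proj _ (quot_lift a) *: adic_proj J n (adic_lift x)
      = adic_proj J n (quot_lift a *: adic_lift x) by apply: adic_scaleE.
  rewrite -raddfD !l'E psi_lin -rmorphM -rmorphD.
  by congr quot_proj; apply: ls_lin.
rewrite l'E phiK; congr quot_proj; apply/seriesP => e /=.
by case: eqP.
Qed.
End SeriesModule.


(** * Universal properties *)

Section QuotientInduced.
Variables (A B : pzRingType) (S : twosided A) (f : {rmorphism A -> B}).
Hypothesis fS : {in S, forall x, f x = 0}.

Definition quot_ind of {in S, forall x, f x = 0} :=
  fun x : quot_ring S => f (quot_lift x).
Local Notation ind := (quot_ind fS).

Lemma quot_indE x : ind (quot_proj S x) = f x.
Proof.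
apply/eqP; rewrite -subr_eq0 -rmorphB; apply/eqP/fS.
exact: quot_lift_sub.
Qed.

Fact quot_ind_zmod : zmod_morphism ind.
Proof.
move=> x y; rewrite -[x]quot_liftK -[y]quot_liftK -rmorphB !quot_indE.
exact: rmorphB.
Qed.
HB.instance Definition _ :=
  GRing.isZmodMorphism.Build (quot_ring S) B ind quot_ind_zmod.

Fact quot_ind_monoid : monoid_morphism ind.
Proof.
split=> [|x y]; first by rewrite -(rmorph1 (quot_proj S)) quot_indE rmorph1.
rewrite -[x]quot_liftK -[y]quot_liftK -rmorphM !quot_indE.
exact: rmorphM.
Qed.
HB.instance Definition _ :=
  GRing.isMonoidMorphism.Build (quot_ring S) B ind quot_ind_monoid.
End QuotientInduced.

Lemma ideal_of_ker (A B : pzRingType) (X : A -> Prop) (f : {rmorphism A -> B}) :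
  (forall x, X x -> f x = 0) -> {in ideal_of X, forall x, f x = 0}.
Proof.
move=> fX x /asboolP; elim=> {x} [|a x b y /fX fx _ fy]; first exact: rmorph0.
by rewrite rmorphD !rmorphM fx mulr0 mul0r fy addr0.
Qed.

Lemma ideal_of_mem (A : pzRingType) (X : A -> Prop) x : X x -> x \in ideal_of X.
Proof.
move=> Xx; apply/asboolP.
rewrite -[x]mulr1 -[X in X * 1]mul1r -[_ * 1]addr0.
exact: generatedD (generated0 _).
Qed.

(** The target is not assumed to satisfy [1 != 0], since it will be built from
    an algebra given by generators and relations. *)
Section FreeAlgebraHom.
Variables (L : comNzRingType) (X : choiceType) (E : algebra L) (t : X -> E).
Local Notation F := (free_alg L X).

Definition free_eval (g : F) : E :=
  \sum_(k <- msupp (g : {malg L[{fmonom X}]}))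
     alg_scalar E (mcoeff k g) * \prod_(x <- (k : seq X)) t x.

Lemma free_evalEw (d : {fset {fmonom X}}) (g : {malg L[{fmonom X}]}) :
  (msupp g `<=` d)%fset -> free_eval g =
    \sum_(k <- d) alg_scalar E (mcoeff k g) * \prod_(x <- (k : seq X)) t x.
Proof.
move=> le; rewrite [LHS](big_fset_incl _ le) => //= x xd /mcoeff_outdom ->.
by rewrite rmorph0 mul0r.
Qed.

Lemma free_evalU c (k : {fmonom X}) :
  free_eval << c *g k >> = alg_scalar E c * \prod_(x <- (k : seq X)) t x.
Proof. by rewrite (free_evalEw msuppU_le) big_seq_fset1 mcoeffUU. Qed.

Fact free_eval_zmod : zmod_morphism free_eval.
Proof.
move=> f g; pose d := (msupp (f : {malg L[{fmonom X}]}) `|`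
   msupp (g : {malg L[{fmonom X}]}))%fset.
rewrite !(@free_evalEw d) ?fsubsetUl ?fsubsetUr ?msuppB_le //.
by rewrite -sumrB; apply: eq_bigr => k _; rewrite mcoeffB rmorphB mulrBl.
Qed.
HB.instance Definition _ :=
  GRing.isZmodMorphism.Build F E free_eval free_eval_zmod.

Lemma free_eval_scalar c : free_eval (alg_scalar F c) = alg_scalar E c.
Proof. by rewrite /= free_evalU fm1 big_nil mulr1. Qed.

Fact free_eval_monoid : monoid_morphism free_eval.
Proof.
split=> [|f g].
  by rewrite -(rmorph1 (alg_scalar F)) free_eval_scalar rmorph1.
rewrite [f * g](malgME (f : {malg L[{fmonom X}]}) g) raddf_sum mulr_suml.
apply: eq_bigr => k _; rewrite raddf_sum mulr_sumr; apply: eq_bigr => l _.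
rewrite /= free_evalU rmorphM -!mulrA; congr (_ * _).
rewrite [RHS]mulrA -alg_central -[RHS]mulrA.
have -> : (mmul k l : seq X) = k ++ l :> seq X.
  by rewrite -[mmul k l]/(fmmul k l) fmmulE.
by rewrite big_cat.
Qed.
HB.instance Definition _ :=
  GRing.isMonoidMorphism.Build F E free_eval free_eval_monoid.

Lemma free_eval_gen x : free_eval (free_gen L x) = t x.
Proof. by rewrite free_evalU rmorph1 mul1r fmuE big_seq1. Qed.
End FreeAlgebraHom.

(** This induction principle also serves to compare homomorphisms on
    generators. *)
Lemma free_alg_ind (L : comNzRingType) (X : choiceType) (P : free_alg L X -> Prop) :
  (forall c, P (alg_scalar (free_alg L X) c)) -> (forall x, P (free_gen L x)) ->
  (forall f g, P f -> P g -> P (f + g)) -> (forall f g, P f -> P g -> P (f * g)) ->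
  forall f, P f.
Proof.
move=> Pc Px PD PM f; rewrite [f]monalgE.
elim/big_ind: _ => [||k _]; first by have := Pc 0; rewrite rmorph0.
  exact: PD.
have -> : << (f : {malg L[{fmonom X}]})@_k *g k >> =
   alg_scalar (free_alg L X) (f : {malg L[{fmonom X}]})@_k * << k >>.
  by rewrite /= -[RHS]/(_ * _ :> {malg L[{fmonom X}]}) malgM_def fgmulUU mul1m mulr1.
apply: (PM) => //; case: k => s; elim: s => [|x s IH].
  have := Pc 1; rewrite rmorph1; congr P.
  by rewrite -[LHS]/(<< fmone X >> : {malg L[{fmonom X}]}) fmoneE.
have -> : << FMonom (x :: s) >> = (free_gen L x) * << FMonom s >> :> free_alg L X.
  rewrite -[RHS]/(_ * _ :> {malg L[{fmonom X}]}) malgM_def fgmulUU mulr1.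
  by rewrite fmuE -[mmul _ _]/(fmmul _ _) fmmulE.
exact: PM.
Qed.

(** ** Extension of a homomorphism to power series *)

Section SeriesExtension.
Variables (I : finType) (K : comPzRingType) (F E : algebra K).
Variable phi : {rmorphism F -> series I E}.
Hypothesis phiC : forall c, phi (alg_scalar F c) = seriesC I (alg_scalar E c).

Definition series_ext (f : series I F) : series I E :=
  Series (fun e => \sum_(d <- below e) coef (phi (coef f d)) (expo_sub e d)).

Fact series_ext_zmod : zmod_morphism series_ext.
Proof.
move=> f g; apply/seriesP => e /=; rewrite -sumrB; apply: eq_bigr => d _.
by rewrite rmorphB.
Qed.
HB.instance Definition _ :=
  GRing.isZmodMorphism.Build (series I F) (series I E) series_ext series_ext_zmod.

Lemma series_ext_mono d a : series_ext (mono d a) = mono d 1 * phi a.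
Proof.
apply/seriesP => e; rewrite coef_mono1M /=; case: ifP => de.
  rewrite (bigD1_seq d) ?below_uniq //= eqxx big1 ?addr0 // => c /negPf->.
  by rewrite rmorph0.
rewrite big1_seq // => c /andP[_ ce]; case: eqP => [cd|_]; rewrite ?rmorph0 //.
by rewrite -cd ce in de.
Qed.

Lemma series_ext_ord n f : f \in ord_ge n -> series_ext f \in ord_ge n.
Proof.
move=> /ord_geP hf; apply/ord_geP => e en /=; rewrite big1_seq // => d /andP[_ de].
by rewrite hf ?rmorph0 //; apply: leq_ltn_trans en; rewrite -(deg_sub de) leq_addr.
Qed.

Lemma series_ext_trunc n f :
  series_ext (trunc n f) = \sum_(d <- expos I n) mono d 1 * phi (coef f d).
Proof. by rewrite raddf_sum; apply: eq_bigr => d _; rewrite /= series_ext_mono. Qed.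

(** Modulo any order a series is a finite sum of monomials, and on monomials
    multiplicativity is clear. *)
Fact series_ext_monoid : monoid_morphism series_ext.
Proof.
split=> [|f g].
  by rewrite -[1]mono0 series_ext_mono rmorph1 mulr1.
apply: ord_ge_eq => n; pose f' := trunc n f; pose g' := trunc n g.
have -> : f * g = f' * g' + ((f - f') * g + f' * (g - g')).
  by rewrite mulrBl mulrBr subrKA addrC subrK.
have -> : series_ext f * series_ext g = series_ext f' * series_ext g' +
   (series_ext (f - f') * series_ext g + series_ext f' * series_ext (g - g')).
  by rewrite !raddfB mulrBl mulrBr subrKA addrC subrK.
rewrite raddfD opprD addrACA rpredD //; last first.
  have [hf hg] := (trunc_ord n f, trunc_ord n g).
  apply: rpredB; [apply: series_ext_ord|]; apply: rpredD.
  - exact: ideal_mulR.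
  - exact: ideal_mulL.
  - exact/ideal_mulR/series_ext_ord.
  exact/ideal_mulL/series_ext_ord.
rewrite [X in X - _](_ : _ = series_ext f' * series_ext g').
  by rewrite subrr rpred0.
rewrite -[LHS]/(series_ext (f' * g')).
rewrite /f' /g' !series_ext_trunc mulr_suml mulr_suml raddf_sum.
apply: eq_bigr => d _; rewrite !mulr_sumr raddf_sum; apply: eq_bigr => e _.
rewrite monoM [LHS]series_ext_mono rmorphM -[1 in LHS]mulr1 -monoM -!mulrA.
by congr (_ * _); rewrite !mulrA (mono1_comm e).
Qed.
HB.instance Definition _ :=
  GRing.isMonoidMorphism.Build (series I F) (series I E) series_ext
    series_ext_monoid.

Lemma series_ext_seriesC a : series_ext (seriesC I a) = phi a.
Proof. by rewrite -mono0 series_ext_mono mono0 rmorph1 mul1r. Qed.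

Lemma series_ext_scalar (c : series I K) :
  series_ext (series_map (alg_scalar F) c) = series_map (alg_scalar E) c.
Proof.
apply/seriesP => e /=; rewrite (bigD1_seq e) ?below_uniq ?below_refl //= phiC.
have -> : expo_sub e e = 0 by apply/ffunP => i; rewrite !ffunE subnn.
rewrite /= eqxx big1_seq ?addr0 // => d /andP[de dbe]; rewrite phiC /=.
case: eqP => // s0; case/eqP: de.
by rewrite -(expo_subDK dbe) s0 addr0.
Qed.

Lemma series_ext_lead n f e : f \in ord_ge n -> deg e = n ->
  coef (series_ext f) e = const_coef (phi (coef f e)).
Proof.
move=> /ord_geP hf en /=; rewrite (bigD1_seq e) ?below_uniq ?below_refl //=.
rewrite big1_seq ?addr0 => [|d /andP[de dbe]]; last first.
  by rewrite hf ?rmorph0 // -en deg_below_lt.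
by congr (coef _ _); apply/ffunP => i; rewrite !ffunE subnn.
Qed.
End SeriesExtension.


(** * Operators on functions with values in an algebra *)

(** Functions on an infinite set are used rather than the algebra itself because
    operators on them can be cut off according to the point where the result is
    evaluated. *)
Section FunctionOperators.
Variables (K : comPzRingType) (A : algebra K) (Omega : Type).
Local Notation W := (Omega -> A).

Record fun_end := FunEnd {
  fop :> W -> W;
  fopP : forall c (x y : W), fop (fun v => alg_scalar A c * x v + y v) =
    (fun v => alg_scalar A c * fop x v + fop y v) }.

HB.instance Definition _ := gen_eqMixin fun_end.
HB.instance Definition _ := gen_choiceMixin fun_end.

Lemma fun_endP (f g : fun_end) : (forall x v, f x v = g x v) <-> f = g.
Proof.
split=> [fg|-> //]; have {fg} : fop f = fop g.
  by apply/funext => x; apply/funext => v.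
by case: f g => [f fP] [g gP] /= fg; subst g; congr FunEnd; apply: Prop_irrelevance.
Qed.

Program Definition fun_end0 := @FunEnd (fun _ _ => 0) _.
Next Obligation. by move=> c x y; apply/funext => v; rewrite mulr0 addr0. Qed.
Program Definition fun_endN (f : fun_end) := @FunEnd (fun x v => - f x v) _.
Next Obligation.
by move=> f c x y; apply/funext => v; rewrite fopP opprD mulrN.
Qed.
Program Definition fun_endD (f g : fun_end) := @FunEnd (fun x v => f x v + g x v) _.
Next Obligation.
by move=> f g c x y; apply/funext => v; rewrite !fopP mulrDr addrACA.
Qed.
Program Definition fun_end1 := @FunEnd (fun x => x) _.
Next Obligation. by []. Qed.
Program Definition fun_endM (f g : fun_end) := @FunEnd (fun x => f (g x)) _.
Next Obligation. by move=> f g c x y; rewrite /= !fopP. Qed.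

Fact fun_end_addA : associative fun_endD.
Proof. by move=> f g h; apply/fun_endP => x v /=; apply: addrA. Qed.
Fact fun_end_addC : commutative fun_endD.
Proof. by move=> f g; apply/fun_endP => x v /=; apply: addrC. Qed.
Fact fun_end_add0 : left_id fun_end0 fun_endD.
Proof. by move=> f; apply/fun_endP => x v /=; apply: add0r. Qed.
Fact fun_end_addN : left_inverse fun_end0 fun_endN fun_endD.
Proof. by move=> f; apply/fun_endP => x v /=; apply: addNr. Qed.
HB.instance Definition _ := GRing.isZmodule.Build fun_end
  fun_end_addA fun_end_addC fun_end_add0 fun_end_addN.

Lemma fun_end_lin (f : fun_end) (x y : W) v :
  f (fun w => x w + y w) v = f x v + f y v.
Proof.
transitivity (f (fun w => alg_scalar A 1 * x w + y w) v); last first.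
  by rewrite fopP rmorph1 mul1r.
by congr (fop f _ v); apply/funext => w; rewrite rmorph1 mul1r.
Qed.

Fact fun_end_mulA : associative fun_endM.
Proof. by move=> f g h; apply/fun_endP. Qed.
Fact fun_end_mul1 : left_id fun_end1 fun_endM.
Proof. by move=> f; apply/fun_endP. Qed.
Fact fun_end_mulr1 : right_id fun_end1 fun_endM.
Proof. by move=> f; apply/fun_endP. Qed.
Fact fun_end_mulDl : left_distributive fun_endM fun_endD.
Proof. by move=> f g h; apply/fun_endP. Qed.
Fact fun_end_mulDr : right_distributive fun_endM fun_endD.
Proof. by move=> f g h; apply/fun_endP => x v /=; rewrite fun_end_lin. Qed.
HB.instance Definition _ := GRing.Zmodule_isPzRing.Build fun_end
  fun_end_mulA fun_end_mul1 fun_end_mulr1 fun_end_mulDl fun_end_mulDr.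

Program Definition fun_end_scalar (c : K) :=
  @FunEnd (fun x v => alg_scalar A c * x v) _.
Next Obligation.
move=> c d x y; apply/funext => v.
by rewrite mulrDr !mulrA -!rmorphM mulrC.
Qed.

Fact fun_end_scalar_zmod : zmod_morphism fun_end_scalar.
Proof. by move=> c d; apply/fun_endP => x v /=; rewrite rmorphB mulrBl. Qed.
HB.instance Definition _ :=
  GRing.isZmodMorphism.Build K fun_end fun_end_scalar fun_end_scalar_zmod.
Fact fun_end_scalar_monoid : monoid_morphism fun_end_scalar.
Proof.
by split=> [|c d]; apply/fun_endP => x v /=; rewrite ?rmorph1 ?mul1r // rmorphM mulrA.
Qed.
HB.instance Definition _ :=
  GRing.isMonoidMorphism.Build K fun_end fun_end_scalar fun_end_scalar_monoid.

Program Definition fun_end_alg : algebra K := @Algebra K fun_end fun_end_scalar _.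
Next Obligation.
move=> c f; apply/fun_endP => x v /=.
have f0 w : f (fun=> 0) w = 0.
  by have := fun_end_lin f (fun=> 0) (fun=> 0) w; rewrite addr0 => /eqP;
     rewrite -subr_eq0 opprD addNKr oppr_eq0 => /eqP.
have -> : (fun v => alg_scalar A c * x v) = (fun v => alg_scalar A c * x v + 0).
  by apply/funext => w; rewrite addr0.
by rewrite fopP f0 addr0.
Qed.

(** When [s] is the inverse of a motion, this operator moves the functions by
    that motion and multiplies them by [a]; therefore composition reverses the
    order of the maps. *)
Program Definition twist (a : A) (s : Omega -> Omega) :=
  @FunEnd (fun x v => a * x (s v)) _.
Next Obligation.
by move=> a s c x y; apply/funext => v; rewrite mulrDr !mulrA alg_central.
Qed.

Lemma twistM a b s t : (twist a s : fun_end) * twist b t = twist (a * b) (t \o s).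
Proof. by apply/fun_endP => x v /=; rewrite mulrA. Qed.

Lemma twist_id : twist 1 id = 1 :> fun_end.
Proof. by apply/fun_endP => x v /=; rewrite mul1r. Qed.

Lemma twistX a s n : (twist a s : fun_end) ^+ n = twist (a ^+ n) (iter n s).
Proof.
elim: n => [|n IH]; first by rewrite !expr0 -twist_id.
by rewrite exprSr IH twistM -exprSr; congr twist.
Qed.

Section Value.
Variable o : Omega.
(** On operators that act on constant functions through multiplication by an
    element of [A], this recovers the element. *)
Definition value_at (f : fun_end) : A := f (fun=> 1) o.
Fact value_at_zmod : zmod_morphism value_at. Proof. by []. Qed.
HB.instance Definition _ :=
  GRing.isZmodMorphism.Build fun_end A value_at value_at_zmod.
End Value.

(** Formally [Y = X + g X g^-1 + g^2 X g^-2 + ...].  Since [g] moves the points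
    of [Omega] up, the sum may be cut at the height of the point where a value
    is computed, and becomes finite; below height [0] the terms are taken from
    the other formal solution [- g^-1 X g - g^-2 X g^2 - ...]. *)
Lemma adjoint_surj (a a' : A) (s s' : Omega -> Omega) (ht : Omega -> int) :
  a * a' = 1 -> a' * a = 1 -> cancel s s' -> cancel s' s ->
  (forall v, ht (s v) = ht v - 1) ->
  forall X : fun_end, exists Y : fun_end,
  Y - twist a s * Y * twist a' s' = X.
Proof.
move=> aa' a'a sK s'K hs X; set g : fun_end := twist a s.
pose g' : fun_end := twist a' s'.
have gg' : g * g' = 1.
  by rewrite twistM aa' -twist_id; congr twist; apply/funext => v; apply: sK.
have g'g : g' * g = 1.
  by rewrite twistM a'a -twist_id; congr twist; apply/funext => v; apply: s'K.
pose y (z : int) : fun_end := match z with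
  | Posz n => \sum_(i < n) g ^+ i * X * g' ^+ i
  | Negz n => - \sum_(i < n.+1) g' ^+ i.+1 * X * g ^+ i.+1 end.
have yE z : y z = X + g * y (z - 1) * g'.
  case: z => [[|n]|n].
  - have -> : Posz 0 - 1 = Negz 0 by [].
    rewrite /y big_ord0 big_ord1 !expr1 mulrN mulNr !mulrA gg'.
    by rewrite mul1r -mulrA gg' mulr1 subrr.
  - have -> : Posz n.+1 - 1 = Posz n by rewrite -addn1 PoszD addrK.
    rewrite /y big_ord_recl !expr0 mul1r mulr1.
    congr (_ + _); rewrite mulr_sumr mulr_suml; apply: eq_bigr => i _.
    by rewrite /= /bump add1n exprS exprSr !mulrA.
  have -> : Negz n - 1 = Negz n.+1 by rewrite !NegzE -opprD -PoszD addn1.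
  rewrite /y [in RHS]big_ord_recl !expr1 mulrN mulNr mulrDr mulrDl opprD addrA.
  rewrite !mulrA gg' mul1r -[X * g * g']mulrA gg' mulr1 subrr add0r; congr (- _).
  rewrite mulr_sumr mulr_suml; apply: eq_bigr => i _.
  rewrite /= /bump add1n [g' ^+ i.+2]exprS [g ^+ i.+2]exprSr !mulrA gg' mul1r.
  by rewrite -[_ * g * g']mulrA gg' mulr1.
have YP c (x w : W) : (fun v => y (ht v) (fun v => alg_scalar A c * x v + w v) v)
    = (fun v => alg_scalar A c * y (ht v) x v + y (ht v) w v).
  by apply/funext => v; rewrite fopP.
exists (FunEnd YP); apply/fun_endP => x v.
rewrite -[LHS]/(y (ht v) x v - (g * y (ht (s v)) * g') x v) hs yE.
by rewrite -[LHS]/(_ + _ - _) addrK.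
Qed.
End FunctionOperators.
Arguments twist {K A Omega} a s.
Arguments value_at {K A Omega} o f.


(** * Solving the product relation *)

(** Up to the central factor [q], the image of the linearized product contains
    the images of [Z |-> Z - h Z h^-1] for [h = s1] and for [h = s1 s2 s1^-1].
    The elements [h] whose image is contained in it form a group, which
    therefore contains the commutator of [s1] and [s2]. *)
Lemma linearized_product_surj (A : pzRingType) (s1 s1' s2 s2' c q q' : A) :
  s1 * s1' = 1 -> s1' * s1 = 1 -> s2 * s2' = 1 -> s2' * s2 = 1 ->
  s1 * s2 * c = q -> (forall a, q * a = a * q) -> q * q' = 1 ->
  (forall X, exists Y, Y - s1 * s2 * s1' * s2' * Y * (s2 * s1 * s2' * s1') = X) ->
  forall X, exists Y1 Y2,
    (Y1 * s1 - s1 * Y1) * s2 * c + s1 * (Y2 * s2 - s2 * Y2) * c = X.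
Proof.
move=> s11' s1'1 s22' s2'2 sc qC qq' surj.
pose br (Y s : A) := Y * s - s * Y.
have brD Y Y' s : br (Y + Y') s = br Y s + br Y' s.
  by rewrite /br mulrDl mulrDr opprD addrACA.
have brN Y s : br (- Y) s = - br Y s by rewrite /br mulNr mulrN -opprD.
pose im X := exists Y1 Y2, br Y1 s1 * s2 * c + s1 * br Y2 s2 * c = X.
have imD X X' : im X -> im X' -> im (X + X').
  move=> [Y1 [Y2 <-]] [Y1' [Y2' <-]]; exists (Y1 + Y1'), (Y2 + Y2').
  by rewrite !brD mulrDr !mulrDl addrACA.
have imN X : im X -> im (- X).
  move=> [Y1 [Y2 <-]]; exists (- Y1), (- Y2).
  by rewrite !brN mulrN !mulNr opprD.
have s2c : s2 * c = s1' * q by rewrite -sc !mulrA s1'1 mul1r.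
have cE : c = s2' * s1' * q.
  by rewrite -mulrA -s2c mulrA s2'2 mul1r.
pose J h h' := forall Z, im (q * (Z - h * Z * h')).
have J1 : J s1 s1'.
  move=> Z; exists Z, 0; rewrite /br !(mul0r, mulr0, subr0, addr0) mulrBr !mulrBl.
  congr (_ - _); first by rewrite -!mulrA [s1 * (s2 * c)]mulrA sc qC.
  by rewrite -!mulrA s2c qC !mulrA.
(* The choice of [Y2] makes the outer factors [s1] and [c] cancel up to [q]. *)
have J2 : J (s1 * s2 * s1') (s1 * s2' * s1').
  move=> Z; exists 0, (s1' * Z * s1); rewrite /br !(mul0r, mulr0, oppr0, add0r).
  rewrite [RHS]mulrBr [s1 * _]mulrBr mulrBl; congr (_ - _).
    by rewrite !mulrA s11' mul1r -!mulrA [s1 * (s2 * c)]mulrA sc qC.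
  by rewrite cE qC !mulrA.
have JM h h' k k' : J h h' -> J k k' -> J (h * k) (k' * h').
  move=> Jh Jk Z; have := imD _ _ (Jk Z) (Jh (k * Z * k')); rewrite -mulrDr.
  by rewrite addrA subrK !mulrA.
have JV h h' : h * h' = 1 -> h' * h = 1 -> J h h' -> J h' h.
  move=> hh' h'h Jh Z; have := imN _ (Jh (h' * Z * h)).
  by rewrite -mulrN opprB !mulrA hh' mul1r -[Z * h * h']mulrA hh' mulr1.
(* With [r = s1 s2 s1^-1], the commutator is [r s1^-1 r^-1 s1]. *)
have Jg : J (s1 * s2 * s1' * s2') (s2 * s1 * s2' * s1').
  have r1 : s1 * s2 * s1' * (s1 * s2' * s1') = 1.
    rewrite -!mulrA [s1' * (s1 * _)]mulrA s1'1 mul1r.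
    by rewrite [s2 * (s2' * _)]mulrA s22' mul1r.
  have r2 : s1 * s2' * s1' * (s1 * s2 * s1') = 1.
    rewrite -!mulrA [s1' * (s1 * _)]mulrA s1'1 mul1r.
    by rewrite [s2' * (s2 * _)]mulrA s2'2 mul1r.
  have := JM _ _ _ _ J2 (JM _ _ _ _ (JV _ _ s11' s1'1 J1)
            (JM _ _ _ _ (JV _ _ r1 r2 J2) J1)).
  rewrite !mulrA; congr J.
    by rewrite -[_ * s1' * s1]mulrA s1'1 mulr1 -[_ * s1' * s1]mulrA s1'1 mulr1.
  rewrite s1'1 mul1r -[_ * s1' * s1 * s1 * s2']mulrA.
  by rewrite -[_ * s1' * s1]mulrA s1'1 mulr1 !mulrA.
move=> X; have [Y YX] := surj (q' * X).
by have := Jg Y; rewrite YX mulrA qq' mul1r.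
Qed.


Section DeformProduct.
Variables (I : finType) (A : pzRingType).
Local Notation SA := (series I A).

Definition unip_pair (g : SA * SA) :=
  [/\ g.1 * g.2 = 1, g.2 * g.1 = 1 & const_coef g.1 = 1].

Definition conj_by (g : SA * SA) (S : SA) := g.1 * S * g.2.

Lemma const_coef_unip g : unip_pair g -> const_coef g.2 = 1.
Proof.
move=> [g12 _ g1]; have := congr1 const_coef g12.
by rewrite rmorphM rmorph1 /= g1 mul1r.
Qed.

Lemma const_coef_conj g S : unip_pair g -> const_coef (conj_by g S) = const_coef S.
Proof.
move=> gu; rewrite !rmorphM /= const_coef_unip //.
by case: gu => _ _ ->; rewrite mul1r mulr1.
Qed.

Lemma unip_limit (u : nat -> SA * SA) : (forall n, unip_pair (u n)) ->
  (forall n, (u n.+1).1 - (u n).1 \in ord_ge n /\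
             (u n.+1).2 - (u n).2 \in ord_ge n) ->
  exists2 g, unip_pair g
    & forall S n, conj_by g S - conj_by (u n) S \in ord_ge n.
Proof.
move=> uu du; have [g hg] := ord_ge_cauchy (fun n => (du n).1).
have [g' hg'] := ord_ge_cauchy (fun n => (du n).2); exists (g, g') => [|S n].
  split=> /=; last first.
  - have [_ _ <-] := uu 1%N; apply/eqP; rewrite -subr_eq0 -rmorphB.
    by have := hg 1%N; rewrite ord_ge1.
  - apply: ord_ge_eq => n; have [_ <- _] := uu n.
    rewrite -[g' * g](subrK ((u n).2 * g)) -addrA -mulrBl -mulrBr.
    by apply: rpredD; [apply/ideal_mulR/hg'|apply/ideal_mulL/hg].
  apply: ord_ge_eq => n; have [<- _ _] := uu n.
  rewrite -[g * g'](subrK ((u n).1 * g')) -addrA -mulrBl -mulrBr.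
  by apply: rpredD; [apply/ideal_mulR/hg|apply/ideal_mulL/hg'].
rewrite /conj_by /= -[g * S * g'](subrK ((u n).1 * S * g')) -addrA.
rewrite -mulrBr -!mulrBl.
by apply: rpredD; [apply/ideal_mulR/ideal_mulR/hg|apply/ideal_mulL/hg'].
Qed.

Variables (S1 S2 R Q : SA).
Local Notation s1 := (const_coef S1).
Local Notation s2 := (const_coef S2).
Local Notation r := (const_coef R).
Hypothesis const_rel : s1 * s2 * r = const_coef Q.
Hypothesis lin_surj : forall X, exists Y1 Y2,
  (Y1 * s1 - s1 * Y1) * s2 * r + s1 * (Y2 * s2 - s2 * Y2) * r = X.

(** To first order, conjugation by [1 + y] adds the commutator of [y]. *)
Lemma conj_step n (y T : SA) : (0 < n)%N -> y \in ord_ge n ->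
  exists2 z, (1 + y) * z = 1 /\ z * (1 + y) = 1
    & z - 1 \in ord_ge n /\
      (1 + y) * T * z - T - (y * T - T * y) \in ord_ge n.+1.
Proof.
move=> n0 hy; have [z [yz zy hz]] := ord_ge_inv n0 hy; exists z => //; split=> //.
pose D := y * T - T * y.
have -> : (1 + y) * T * z - T - D = D * (z - 1).
  have -> : (1 + y) * T = T * (1 + y) + D.
    by rewrite /D mulrDl mulrDr mul1r mulr1 -addrA [T * y + _]addrC subrK.
  by rewrite mulrDl -mulrA yz mulr1 mulrBr mulr1 [T + _]addrC addrK.
apply: (@ord_ge_le _ _ _ (n + n)); first by rewrite -[n.+1]addn1 leq_add2l.
by apply: ord_geM => //; apply: rpredB; [apply: ideal_mulR|apply: ideal_mulL].
Qed.

(** The error of lowest degree [n] is removed by homogeneous [y1] and [y2] of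
    degree [n], whose coefficients solve the linear equation for each coefficient
    of the error; the terms neglected have degree at least [2 n]. *)
Lemma product_step n (g1 g2 : SA * SA) : (0 < n)%N -> unip_pair g1 -> unip_pair g2 ->
  conj_by g1 S1 * conj_by g2 S2 * R - Q \in ord_ge n ->
  exists h1 h2, [/\ unip_pair h1, unip_pair h2,
    (h1.1 - g1.1 \in ord_ge n /\ h1.2 - g1.2 \in ord_ge n),
    (h2.1 - g2.1 \in ord_ge n /\ h2.2 - g2.2 \in ord_ge n)
    & conj_by h1 S1 * conj_by h2 S2 * R - Q \in ord_ge n.+1].
Proof.
move=> n0 u1 u2; set T1 := conj_by g1 S1; set T2 := conj_by g2 S2.
set Err := _ - Q => hE.
have [Y1 hY1] := choice (fun e : {ffun I -> nat} => lin_surj (- coef Err e)).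
have [Y2 hY] := choice hY1.
pose hom (Y : {ffun I -> nat} -> A) : SA :=
  Series (fun e => if deg e == n then Y e else 0).
have hom_ord Y : hom Y \in ord_ge n.
  by apply/ord_geP => e en /=; rewrite ltn_eqF.
have coef_hom Y e : deg e = n -> coef (hom Y) e = Y e by move=> /= ->; rewrite eqxx.
pose y1 := hom Y1; pose y2 := hom Y2.
have [z1 [yz1 zy1] [hz1 hT1]] := conj_step T1 n0 (hom_ord Y1).
have [z2 [yz2 zy2] [hz2 hT2]] := conj_step T2 n0 (hom_ord Y2).
have newpair (y z : SA) (g : SA * SA) : y \in ord_ge n -> (1 + y) * z = 1 ->
    z * (1 + y) = 1 -> z - 1 \in ord_ge n -> unip_pair g ->
    unip_pair ((1 + y) * g.1, g.2 * z) /\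
    ((1 + y) * g.1 - g.1 \in ord_ge n /\ g.2 * z - g.2 \in ord_ge n).
  move=> hy yz zy hz [g12 g21 gc]; split; first split=> /=.
  - by rewrite -mulrA [g.1 * _]mulrA g12 mul1r.
  - by rewrite -mulrA [z * _]mulrA zy mul1r.
  - rewrite -[LHS]/(const_coef ((1 + y) * g.1)) rmorphM rmorphD rmorph1 /= gc mulr1.
    have : y \in ord_ge 1 by apply: ord_ge_le hy.
    by rewrite ord_ge1 => /eqP; rewrite /const_coef => ->; rewrite addr0.
  split; first by rewrite mulrDl mul1r addrAC subrr add0r ideal_mulR.
  by rewrite -[X in _ - X]mulr1 -mulrBr; apply: ideal_mulL.
have [p1 d1] := newpair _ _ _ (hom_ord Y1) yz1 zy1 hz1 u1.
have [p2 d2] := newpair _ _ _ (hom_ord Y2) yz2 zy2 hz2 u2.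
exists ((1 + y1) * g1.1, g1.2 * z1), ((1 + y2) * g2.1, g2.2 * z2); split=> //.
have conjE (y z : SA) (g : SA * SA) S :
    conj_by ((1 + y) * g.1, g.2 * z) S = (1 + y) * conj_by g S * z.
  by rewrite /conj_by /= !mulrA.
rewrite !conjE -/T1 -/T2.
set T1' := (1 + y1) * T1 * z1; set T2' := (1 + y2) * T2 * z2.
pose D1 := y1 * T1 - T1 * y1; pose D2 := y2 * T2 - T2 * y2.
have hD1 : D1 \in ord_ge n.
  by apply: rpredB; [apply/ideal_mulR/hom_ord|apply/ideal_mulL/hom_ord].
have hD2 : D2 \in ord_ge n.
  by apply: rpredB; [apply/ideal_mulR/hom_ord|apply/ideal_mulL/hom_ord].
have hA1 : T1' - T1 \in ord_ge n.
  by rewrite -(subrK D1 (_ - _)) rpredD //; apply: ord_ge_le hT1.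
have -> : T1' * T2' * R - Q =
   (T1' - T1 - D1) * T2' * R + D1 * (T2' - T2) * R + T1 * (T2' - T2 - D2) * R
   + (Err + (D1 * T2 * R + T1 * D2 * R)).
  rewrite /Err.
  have -> : T1' * T2' * R = (T1' - T1 - D1) * T2' * R + (T1 * T2' * R + D1 * T2' * R).
    by rewrite -!mulrDl -[T1' - T1 - D1]addrA -opprD subrK.
  have -> : D1 * T2' * R = D1 * (T2' - T2) * R + D1 * T2 * R.
    by rewrite -mulrDl -mulrDr subrK.
  have -> : T1 * T2' * R = T1 * (T2' - T2 - D2) * R + (T1 * T2 * R + T1 * D2 * R).
    by rewrite -!mulrDl -!mulrDr -[T2' - T2 - D2]addrA -opprD subrK.
  set a := (_ - D1) * _ * _; set b := D1 * (_ - _) * _; set c := T1 * (_ - _) * _.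
  set d := T1 * T2 * R; set e := T1 * D2 * R; set f := D1 * T2 * R.
  by rewrite !addrA [RHS](ACl (1*3*4*7*2*6*5)).
have hA2 : T2' - T2 \in ord_ge n.
  by rewrite -(subrK D2 (_ - _)) rpredD //; apply: ord_ge_le hT2.
rewrite rpredD //.
  apply: rpredD; [apply: rpredD|].
  - by do 2 apply: ideal_mulR.
  - apply: ideal_mulR; apply: (@ord_ge_le _ _ _ (n + n)); last exact: ord_geM.
    by rewrite -[n.+1]addn1 leq_add2l.
  by apply/ideal_mulR/ideal_mulL.
have cT1 : coef T1 0 = s1 by apply: const_coef_conj.
have cT2 : coef T2 0 = s2 by apply: const_coef_conj.
apply: ord_geS => [|e en].
  apply: (rpredD hE); apply: rpredD; first by do 2 apply: ideal_mulR.
  exact/ideal_mulR/ideal_mulL.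
rewrite -[LHS]/(coef Err e + (coef (D1 * T2 * R) e + coef (T1 * D2 * R) e)).
have hDT : D1 * T2 \in ord_ge n by apply: ideal_mulR.
have hTD : T1 * D2 \in ord_ge n by apply: ideal_mulL.
rewrite (coefM_leadl _ hDT) // (coefM_leadl _ hD1) //.
rewrite (coefM_leadl _ hTD) // (coefM_leadr _ hD2) //.
rewrite -[coef D1 e]/(coef (y1 * T1) e - coef (T1 * y1) e).
rewrite -[coef D2 e]/(coef (y2 * T2) e - coef (T2 * y2) e).
rewrite (coefM_leadl _ (hom_ord Y1)) // (coefM_leadr _ (hom_ord Y1)) //.
rewrite (coefM_leadl _ (hom_ord Y2)) // (coefM_leadr _ (hom_ord Y2)) //.
by rewrite cT1 cT2 !coef_hom // hY addrN.
Qed.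

Lemma deform_product : exists g1 g2, [/\ unip_pair g1, unip_pair g2
  & conj_by g1 S1 * conj_by g2 S2 * R = Q].
Proof.
pose st := {p : (SA * SA) * (SA * SA) * nat | [/\ unip_pair p.1.1, unip_pair p.1.2
  & conj_by p.1.1 S1 * conj_by p.1.2 S2 * R - Q \in ord_ge p.2.+1]}.
have next (p : st) : exists p' : st, (sval p').2 = (sval p).2.+1 /\
   [/\ (sval p').1.1.1 - (sval p).1.1.1 \in ord_ge (sval p).2.+1,
       (sval p').1.1.2 - (sval p).1.1.2 \in ord_ge (sval p).2.+1,
       (sval p').1.2.1 - (sval p).1.2.1 \in ord_ge (sval p).2.+1
     & (sval p').1.2.2 - (sval p).1.2.2 \in ord_ge (sval p).2.+1].
  case: p => [[[g1 g2] n] /= [u1 u2 hE]].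
  have [h1 [h2 [v1 v2 [d1 d1'] [d2 d2'] hE']]] := product_step (ltn0Sn n) u1 u2 hE.
  pose Pp (p : (SA * SA) * (SA * SA) * nat) := [/\ unip_pair p.1.1, unip_pair p.1.2
    & conj_by p.1.1 S1 * conj_by p.1.2 S2 * R - Q \in ord_ge p.2.+1].
  by exists (exist Pp (h1, h2, n.+1) (And3 v1 v2 hE')).
have [f hf] := choice next.
have u0 : unip_pair (1, 1) by split; rewrite ?mulr1 //; apply: (rmorph1 const_coef).
have p0 : [/\ unip_pair (1, 1), unip_pair (1, 1)
    & conj_by (1, 1) S1 * conj_by (1, 1) S2 * R - Q \in ord_ge 1].
  have c1 S : conj_by (1, 1) S = S by rewrite /conj_by mul1r mulr1.
  split=> //; rewrite !c1 ord_ge1; apply/eqP.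
  rewrite -[LHS]/(const_coef (S1 * S2 * R) - const_coef Q) !rmorphM -const_rel.
  by rewrite subrr.
pose x0 : st := exist _ ((1, 1), (1, 1), 0%N) p0.
pose x n := iter n f x0.
have xn n : (sval (x n)).2 = n.
  by elim: n => //= n IH; have [-> _] := hf (x n); rewrite IH.
have [|g1 u1 c1] := @unip_limit (fun n => (sval (x n)).1.1)
  (fun n => let: And3 u _ _ := svalP (x n) in u).
  move=> n; have [_ [d1 d1' _ _]] := hf (x n); rewrite xn in d1 d1'.
  by split; [apply: ord_ge_le d1|apply: ord_ge_le d1'].
have [|g2 u2 c2] := @unip_limit (fun n => (sval (x n)).1.2)
  (fun n => let: And3 _ u _ := svalP (x n) in u).
  move=> n; have [_ [_ _ d2 d2']] := hf (x n); rewrite xn in d2 d2'.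
  by split; [apply: ord_ge_le d2|apply: ord_ge_le d2'].
exists g1, g2; split=> //; apply: ord_ge_eq => n.
have [_ _ hn] := svalP (x n); rewrite xn in hn.
move: (c1 S1 n) (c2 S2 n) hn; set T1 := conj_by _ S1; set T2 := conj_by _ S2.
set U1 := conj_by _ S1; set U2 := conj_by _ S2 => h1 h2 hn.
have -> : T1 * T2 * R - Q =
    (T1 - U1) * T2 * R + U1 * (T2 - U2) * R + (U1 * U2 * R - Q).
  by rewrite !(mulrBl, mulrBr) !subrKA.
apply: rpredD; last exact: ord_ge_le hn.
by apply: rpredD; [apply/ideal_mulR/ideal_mulR|apply/ideal_mulR/ideal_mulL].
Qed.
End DeformProduct.


(** * Deformed presentations *)

(** [rel] deforms the relations [rel0]: its constant terms are the relations
    [rel0], up to consequences of these.  The algebra [H] presented by [rel] is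
    compared with [A0[[tau]]] by means of a representation of [H]. *)
Section Deformed.
Variables (I : finType) (K : comPzRingType) (F : algebra K).
Variables (rel0 : F -> Prop) (rel : series_alg I F -> Prop).
Hypothesis rel_const : forall x, rel x -> const_coef x \in ideal_of rel0.
Hypothesis rel_lift : forall r, rel0 r -> exists2 x, rel x & const_coef x = r.

Local Notation FI := (series_alg I F).
Local Notation A0 := (quot_alg (ideal_of rel0)).
Local Notation H :=
  (quot_alg (adic_closure (A := FI) (aug_ideal I K) (ideal_of rel))).

Lemma mem_closure (f : FI) :
  f \in adic_closure (aug_ideal I K) (ideal_of rel) <->
  forall n, exists2 y : FI, y \in ideal_of rel & f - y \in ord_ge n.
Proof.
by split=> [/asboolP hf n|hf]; [|apply/asboolP => n];
  have [y yi hy] := hf n; exists y => //; rewrite ?adic_series in hy *.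
Qed.

Lemma const_coef_ideal (f : FI) :
  f \in ideal_of rel -> const_coef f \in ideal_of rel0.
Proof.
move=> /asboolP; elim=> {f} [|a x b y relx _ IH]; first by rewrite rmorph0 rpred0.
rewrite rmorphD !rmorphM rpredD //.
exact/ideal_mulR/ideal_mulL/rel_const.
Qed.

Lemma const_coef_closure (f : FI) :
  f \in adic_closure (aug_ideal I K) (ideal_of rel) ->
  const_coef f \in ideal_of rel0.
Proof.
move=> /mem_closure/(_ 1%N)[y yi]; rewrite ord_ge1 -[coef _ _]/(const_coef _).
by rewrite rmorphB subr_eq0 => /eqP->; apply: const_coef_ideal.
Qed.

Lemma ideal_of_lift r : r \in ideal_of rel0 ->
  exists2 y : FI, y \in ideal_of rel & const_coef y = r.
Proof.
move=> /asboolP; elim=> {r} [|a x b y /rel_lift[x' relx' x'x] _ [y' iy' y'y]].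
  by exists 0; rewrite ?rpred0 ?rmorph0.
exists (seriesC I a * x' * seriesC I b + y').
  by rewrite rpredD //; apply/ideal_mulR/ideal_mulL/ideal_of_mem.
by rewrite rmorphD !rmorphM /= x'x y'y /const_coef /= eqxx.
Qed.

Fact const_coef_ker : {in adic_closure (A := FI) (aug_ideal I K) (ideal_of rel),
  forall f, (quot_proj (ideal_of rel0) \o const_coef) f = 0}.
Proof.
move=> f /const_coef_closure hf; rewrite /= -(rmorph0 (quot_proj (ideal_of rel0))).
by apply/quot_proj_eq; rewrite subr0.
Qed.

Definition reduction : H -> A0 := quot_ind const_coef_ker.
HB.instance Definition _ := GRing.RMorphism.on reduction.

Lemma reductionE (f : FI) :
  reduction (quot_proj _ f) = quot_proj _ (const_coef f).
Proof. exact: quot_indE. Qed.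

Variables (E : algebra K) (ev : {additive E -> A0}).
Hypothesis evZ : forall c x, ev (alg_scalar E c * x) = alg_scalar A0 c * ev x.
Variable phi : {rmorphism F -> series I E}.
Hypothesis phiC : forall c, phi (alg_scalar F c) = seriesC I (alg_scalar E c).
Hypothesis phi_rel : forall x, rel x -> series_ext phi x = 0.
Hypothesis ev_phi : forall f, ev (const_coef (phi f)) = quot_proj _ f.

(** When [ev] is the evaluation at a vector, this is the orbit map of that
    vector. *)
Definition normal_form0 (f : FI) : series I A0 :=
  Series (fun e => ev (coef (series_ext phi f) e)).
Fact normal_form0_zmod : zmod_morphism normal_form0.
Proof.
move=> f g; apply/seriesP => e.
rewrite -[LHS]/(ev (coef (series_ext phi (f - g)) e)).
by rewrite (raddfB (series_ext phi)); apply: (raddfB ev).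
Qed.
HB.instance Definition _ :=
  GRing.isZmodMorphism.Build FI (series I A0) normal_form0 normal_form0_zmod.

Lemma normal_form0_closure (f : FI) :
  f \in adic_closure (aug_ideal I K) (ideal_of rel) -> normal_form0 f = 0.
Proof.
move=> /mem_closure hf.
have f0 : series_ext phi f = 0.
  apply: ord_ge_eq0 => n; have [y yi hy] := hf n.
  rewrite -(subrK y f) rmorphD /= (ideal_of_ker (f := series_ext phi) phi_rel yi).
  by rewrite addr0; apply: series_ext_ord.
apply/seriesP => e; rewrite -[LHS]/(ev (coef (series_ext phi f) e)) f0.
exact: (raddf0 ev).
Qed.

Definition normal_form (x : H) : series I A0 := normal_form0 (quot_lift x).

Lemma normal_formE (f : FI) : normal_form (quot_proj _ f) = normal_form0 f.
Proof.
apply/eqP; rewrite -subr_eq0 -raddfB; apply/eqP/normal_form0_closure.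
exact: quot_lift_sub.
Qed.

Fact normal_form_zmod : zmod_morphism normal_form.
Proof.
move=> x y; rewrite -[x]quot_liftK -[y]quot_liftK.
by rewrite -[_ - _]raddfB !normal_formE raddfB.
Qed.
Lemma normal_formD x y : normal_form (x + y) = normal_form x + normal_form y.
Proof.
have sN z : normal_form (- z) = - normal_form z.
  have s0 : normal_form 0 = 0 by rewrite -(subrr (0 : H)) normal_form_zmod subrr.
  by rewrite -sub0r normal_form_zmod s0 sub0r.
by rewrite -[y in LHS]opprK normal_form_zmod sN opprK.
Qed.

Lemma normal_formZ (c : series I K) (x : H) :
  normal_form (alg_scalar H c * x) = alg_scalar (series_alg I A0) c * normal_form x.
Proof.
rewrite -[x]quot_liftK; set f := quot_lift x.
have -> : alg_scalar H c * quot_proj _ f = quot_proj _ (alg_scalar FI c * f).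
  by rewrite [RHS]rmorphM.
rewrite !normal_formE.
apply/seriesP => e.
rewrite -[LHS]/(ev (coef (series_ext phi (series_map (alg_scalar F) c * f)) e)).
have extM a b : series_ext phi (a * b) = series_ext phi a * series_ext phi b.
  exact: rmorphM.
rewrite extM series_ext_scalar // raddf_sum.
by apply: eq_bigr => d _; apply: evZ.
Qed.

Lemma normal_form0_ord n f : f \in ord_ge n -> normal_form0 f \in ord_ge n.
Proof.
move=> hf; apply/ord_geP => e en; rewrite -[LHS]/(ev (coef (series_ext phi f) e)).
by have /ord_geP-> := series_ext_ord phi hf; rewrite ?raddf0.
Qed.

(** On the lowest coefficients the representation acts through its constant
    term, that is through the undeformed algebra. *)
Lemma normal_form0_lead n (f : FI) e : f \in ord_ge n -> deg e = n ->
  coef (normal_form0 f) e = quot_proj _ (coef f e).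
Proof.
move=> hf en; rewrite -[LHS]/(ev (coef (series_ext phi f) e)).
by rewrite (series_ext_lead _ hf en) ev_phi.
Qed.

(** If [f] agrees with an element [y] of the ideal up to order [n], the
    coefficients of degree [n] of [f - y] vanish in [A0]; they are constant terms
    of elements of the ideal, which improve [y]. *)
Lemma normal_form0_ker (f : FI) : normal_form0 f = 0 ->
  f \in adic_closure (aug_ideal I K) (ideal_of rel).
Proof.
move=> f0; apply/mem_closure; elim=> [|n [y yi hy]].
  by exists 0; rewrite ?rpred0 // ord_ge0.
have yn e : deg e = n -> coef (f - y) e \in ideal_of rel0.
  have sy : normal_form0 y = 0.
    by apply/normal_form0_closure/mem_closure => k; exists y; rewrite // subrr rpred0.
  have sfy : normal_form0 (f - y) = 0.
    by rewrite [LHS](raddfB normal_form0) /= f0 sy subrr.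
  move=> en; have := normal_form0_lead hy en; rewrite sfy => /esym.
  rewrite -[coef 0 e]/(0 : A0) -(rmorph0 (quot_proj (ideal_of rel0))).
  by move/quot_proj_eq; rewrite subr0.
have /choice[z hz] : forall e, exists z : FI, z \in ideal_of rel /\
    (deg e = n -> const_coef z = coef (f - y) e).
  move=> e; case: (deg e =P n) => [en|ne]; last first.
    by exists 0; split=> [|/ne//]; rewrite rpred0.
  by have [z zi zE] := ideal_of_lift (yn e en); exists z.
pose w : FI := \sum_(d <- expos I n | deg d == n) mono d 1 * z d.
exists (y + w).
  by rewrite rpredD // rpred_sum // => d _; apply: ideal_mulL; case: (hz d).
have wn : w \in ord_ge n.
  rewrite rpred_sum // => d /eqP dn; apply: ideal_mulR.
  by rewrite ord_ge_mono // dn.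
rewrite opprD addrA; apply: ord_geS => [|e en]; first by rewrite rpredB.
rewrite -[LHS]/(coef (f - y) e - coef w e) series_coef_sum big_mkcond.
rewrite (bigD1_seq e) ?expos_uniq ?mem_expos ?en ?eqxx //.
rewrite [X in _ - (_ + X)]big1_seq ?addr0.
  rewrite coef_mono1M below_refl.
  have -> : expo_sub e e = 0 by apply/ffunP => i; rewrite !ffunE subnn.
  have [_ /(_ en) ze] := hz e; rewrite -[coef _ 0]/(const_coef (z e)) ze.
  exact: subrr.
move=> d /andP[de _]; case: eqP => // dn.
rewrite -[LHS]/(coef (mono d 1 * z d) e) coef_mono1M; case: ifP => // dbe.
by have := deg_below_lt dbe de; rewrite dn en ltnn.
Qed.

(** Any lift of the error, coefficient by coefficient, corrects its lowest
    coefficients. *)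
Lemma normal_form_surj (g : series I A0) : exists f, normal_form0 f = g.
Proof.
pose v n (u : FI) : FI := Series (fun e =>
  if deg e == n then quot_lift (coef (g - normal_form0 u) e) else 0).
have hv n u : v n u \in ord_ge n.
  by apply/ord_geP => e en /=; rewrite ltn_eqF.
pose u := fix u n : FI := if n is k.+1 then u k + v k (u k) else 0.
have hu n : g - normal_form0 (u n) \in ord_ge n.
  elim: n => [|n IH]; first exact: ord_ge0.
  rewrite /= raddfD opprD addrA; apply: ord_geS => [|e en].
    by rewrite rpredB // normal_form0_ord.
  rewrite -[LHS]/(coef (g - normal_form0 (u n)) e - coef (normal_form0 (v n (u n))) e).
  by rewrite (normal_form0_lead (hv _ _) en) /= en eqxx quot_liftK subrr.
have [f hf] : exists f : FI, forall n, f - u n \in ord_ge n.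
  by apply: (@ord_ge_cauchy I F u) => n; rewrite /= addrAC subrr add0r.
exists f; apply: ord_ge_eq => n.
rewrite -(subrK (normal_form0 (u n)) (normal_form0 f)) -addrA -raddfB.
rewrite rpredD ?normal_form0_ord //.
by rewrite -opprB rpredN.
Qed.

Lemma normal_form_bij : bijective normal_form.
Proof.
have [tau tauK] := choice normal_form_surj.
exists (fun g => quot_proj _ (tau g)) => [x|g]; last by rewrite normal_formE.
rewrite -[RHS]quot_liftK; apply/quot_proj_eq/normal_form0_ker.
by rewrite raddfB /= tauK subrr.
Qed.

Lemma normal_form_const x : const_coef (normal_form x) = reduction x.
Proof.
rewrite -[x]quot_liftK normal_formE reductionE.
by rewrite /const_coef (@normal_form0_lead 0) ?ord_ge0 ?deg0.
Qed.
End Deformed.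


(** * Roots of unity *)

Section ComplexRoots.
Variable R : realType.
Local Notation C := (complexes R).

Definition expi (x : R) : C := Complex (trigo.cos x) (trigo.sin x).

Lemma expiD x y : expi (x + y) = expi x * expi y.
Proof.
rewrite /expi trigo.cosD trigo.sinD; congr Complex.
by rewrite addrC.
Qed.

Lemma expiMn x n : expi (x *+ n) = expi x ^+ n.
Proof.
elim: n => [|n IH]; last by rewrite mulrSr expiD IH exprSr.
by rewrite mulr0n expr0 /expi trigo.cos0 trigo.sin0.
Qed.

Lemma expi_fracE a b : expi_frac R a b = expi_frac R 1 b ^+ a.
Proof.
rewrite -[RHS]expiMn /expi_frac -/(expi _); congr expi.
by rewrite mulr1 -[RHS]mulr_natr [RHS]mulrAC.
Qed.

Lemma expi_neq1 (y : R) : 0 < y < trigo.pi -> expi (y *+ 2) != 1.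
Proof.
move=> hy; apply/eqP => -[+ _]; rewrite trigo.cos_mulr2n => /eqP.
rewrite subr_eq -mulr2n -mulr_natr -[X in _ == X]mulr_natr.
rewrite (inj_eq (mulIf _)) ?pnatr_eq0 //.
rewrite trigo.cos2sin2 -subr_eq0 addrAC subrr add0r oppr_eq0 sqrf_eq0.
by rewrite gt_eqF // trigo.sin_gt0_pi.
Qed.

Lemma expi_frac_prim d : (0 < d)%N -> d.-primitive_root (expi_frac R 1 d).
Proof.
move=> d0; have dR : d%:R != 0 :> R by rewrite pnatr_eq0 -lt0n.
rewrite /primitive_root_of_unity d0; apply/forallP => i; apply/eqP.
rewrite unity_rootE -expi_fracE /expi_frac -/(expi _).
case: (ltngtP i.+1 d) => [lt_id|/(leq_trans (ltn_ord i))|->].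
- apply/negbTE; have -> : 2 * trigo.pi * i.+1%:R / d%:R
      = (trigo.pi * (i.+1%:R / d%:R)) *+ 2 :> R.
    by rewrite -[RHS]mulr_natl !mulrA.
  apply: expi_neq1; rewrite mulr_gt0 ?divr_gt0 ?ltr0n ?trigo.pi_gt0 //=.
  by rewrite gtr_pMr ?trigo.pi_gt0 // ltr_pdivrMr ?ltr0n // mul1r ltr_nat.
- by rewrite ltnn.
rewrite mulfK // mulr_natl /expi trigo.cos2pi trigo.sin2pi.
exact: eqxx.
Qed.
End ComplexRoots.

Section RootSums.
Variables (C : fieldType) (d : nat) (z : C).
Hypothesis z_prim : d.-primitive_root z.

Definition rootz (j : nat) := z ^+ j.+1.

Lemma prod_rootz : \prod_(j < d) ('X - (rootz j)%:P) = 'X^d - 1.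
Proof.
rewrite -(factor_Xn_sub_1 z_prim) big_mkord; have := prim_expr_order z_prim.
have := prim_order_gt0 z_prim; rewrite /rootz; case: d => // n _ zn.
by rewrite big_ord_recr big_ord_recl /= mulrC zn expr0.
Qed.

Lemma geom_root_sum (w : C) : w ^+ d = 1 -> w != 1 -> \sum_(i < d) w ^+ i = 0.
Proof.
move=> wd w1; apply/eqP; have /esym/eqP := subrX1 w d.
by rewrite wd subrr mulf_eq0 subr_eq0 (negPf w1).
Qed.

Lemma rootzX k : (rootz k) ^+ d = 1.
Proof. by rewrite -exprM mulnC exprM (prim_expr_order z_prim) expr1n. Qed.

Lemma rootz_neq0 k : rootz k != 0.
Proof.
apply/eqP => z0; have := rootzX k; rewrite z0 expr0n.
have := prim_order_gt0 z_prim; case: d => //= n _ /esym/eqP.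
by rewrite oner_eq0.
Qed.

Lemma rootz_inj (i j : 'I_d) : rootz i = rootz j -> i = j.
Proof.
move=> /eqP; rewrite /rootz (eq_prim_root_expr z_prim).
rewrite -[i.+1]addn1 -[j.+1]addn1 eqn_modDr.
by rewrite !modn_small // => /eqP/val_inj.
Qed.

Lemma rootz_orth (i j : 'I_d) : i != j ->
  \sum_(k < d) (rootz i / rootz j) ^+ k = 0.
Proof.
move=> ij; apply: geom_root_sum; first by rewrite expr_div_n !rootzX divr1.
apply: contra ij => /eqP e; apply/eqP/rootz_inj.
by rewrite -[rootz i](divfK (rootz_neq0 j)) e mul1r.
Qed.

Lemma rootz_sum (k : nat) : (0 < k < d)%N -> \sum_(j < d) (rootz j) ^- k = 0.
Proof.
move=> /andP[k0 kd]; have zk1 : z ^- k != 1.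
  rewrite -invr1 (inj_eq invr_inj) -(prim_order_dvd z_prim) gtnNdvd //.
transitivity (\sum_(j < d) z ^- k * (z ^- k) ^+ j).
  by apply: eq_bigr => j _; rewrite -exprS exprVn /rootz exprAC.
rewrite -mulr_sumr geom_root_sum ?mulr0 // exprVn -exprM mulnC exprM.
by rewrite (prim_expr_order z_prim) expr1n invr1.
Qed.
End RootSums.

(** ** A deformation of an element of finite order *)

Section Idempotents.
Variables (C : fieldType) (d : nat) (z : C) (A : pzRingType).
Variables (iota : {rmorphism C -> A}) (T : A).
Hypotheses (z_prim : d.-primitive_root z) (dC : d%:R != 0 :> C).
Hypothesis iotaC : forall c a, iota c * a = a * iota c.
Local Notation w := (rootz z).

(** The identity of polynomials [prod_rootz] holds at [T], although [A] is not
    commutative, because the coefficients are central. *)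
Lemma prod_subr_rootz : \prod_(j < d) (T - iota (w j)) = T ^+ d - 1.
Proof.
pose ev n (p : {poly C}) := \sum_(i < n) iota p`_i * T ^+ i.
have evM n (p : {poly C}) c : (size p <= n)%N ->
    ev n.+1 (('X - c%:P) * p) = (T - iota c) * ev n p.
  move=> hp; rewrite /ev mulrBl.
  have -> : iota c * (\sum_(i < n) iota p`_i * T ^+ i) =
            \sum_(i < n.+1) iota (c * p`_i) * T ^+ i.
    rewrite big_ord_recr /= nth_default // mulr0 rmorph0 mul0r addr0 mulr_sumr.
    by apply: eq_bigr => i _; rewrite rmorphM mulrA.
  have -> : T * (\sum_(i < n) iota p`_i * T ^+ i) =
            \sum_(i < n.+1) iota ('X * p)`_i * T ^+ i.
    rewrite big_ord_recl coefXM rmorph0 mul0r add0r mulr_sumr.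
    apply: eq_bigr => i _; rewrite coefXM /= /bump /=.
    by rewrite mulrA -iotaC -mulrA -exprS.
  rewrite -sumrB; apply: eq_bigr => i _.
  by rewrite mulrBl coefB coefCM rmorphB mulrBl.
have evP (r : seq 'I_d) : \prod_(j <- r) (T - iota (w j)) =
    ev (size r).+1 (\prod_(j <- r) ('X - (w j)%:P)).
  elim: r => [|j r IH].
    by rewrite !big_nil /ev big_ord1 coefC /= rmorph1 mulr1.
  rewrite !big_cons IH /= evM //.
  by rewrite size_prod_XsubC.
have := evP (index_enum 'I_d); rewrite (prod_rootz z_prim) => ->.
have -> : size (index_enum 'I_d) = d by rewrite -[RHS](card_ord d) cardT enumT.
rewrite /ev; have := prim_order_gt0 z_prim; case: (d) => // n _.
rewrite big_ord_recr big_ord_recl /= big1 ?addr0 => [|i _].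
  rewrite !coefB !coefXn !coefC eqxx /= sub0r subr0 rmorphN !rmorph1 mul1r mulr1.
  by rewrite addrC.
rewrite coefB coefXn coefC /= /bump /= add1n eqSS ltn_eqF // subrr rmorph0.
by rewrite mul0r.
Qed.

Hypothesis Td : T ^+ d = 1.

(** The projection on the eigenspace of [T] for [w j], by Fourier inversion on
    the cyclic group generated by [T]. *)
Definition idem (j : 'I_d) : A :=
  \sum_(i < d) iota (d%:R^-1 * (w j) ^- i) * T ^+ i.

Lemma mul_idem j : T * idem j = iota (w j) * idem j.
Proof.
have wj0 := rootz_neq0 z_prim j.
rewrite /idem !mulr_sumr.
have -> : \sum_(i < d) T * (iota (d%:R^-1 * (w j) ^- i) * T ^+ i) =
    \sum_(i < d) iota (w j) * (iota (d%:R^-1 * (w j) ^- i.+1) * T ^+ i.+1).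
  apply: eq_bigr => i _; rewrite mulrA -iotaC -mulrA -exprS mulrA -rmorphM.
  by congr (iota _ * _); rewrite mulrCA exprS invfM mulVKf.
have := prim_order_gt0 z_prim; have := rootzX z_prim j; move: Td wj0.
case: (d) (w j) => // n x Tn x0 xn _.
rewrite big_ord_recr big_ord_recl /= addrC Tn xn !expr0; congr (_ + _).
Qed.

Lemma sum_idem : \sum_j idem j = 1.
Proof.
rewrite exchange_big /=; have d0 := prim_order_gt0 z_prim.
rewrite (bigD1 (Ordinal d0)) //= [X in _ + X]big1 ?addr0 => [|i i0].
  rewrite -mulr_suml -rmorph_sum -mulr_sumr expr0 mulr1.
  under eq_bigr do rewrite expr0 invr1.
  by rewrite sumr_const card_ord mulVf // rmorph1.
rewrite -mulr_suml -rmorph_sum -mulr_sumr (rootz_sum z_prim) ?mulr0 ?rmorph0 ?mul0r //.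
by rewrite ltn_ord andbT lt0n; apply: contra i0 => /eqP i0; apply/eqP/val_inj.
Qed.

Lemma mulX_idem k j : T ^+ k * idem j = iota (w j ^+ k) * idem j.
Proof.
elim: k => [|k IH]; first by rewrite !expr0 rmorph1.
by rewrite exprSr -mulrA mul_idem mulrA -iotaC -mulrA IH mulrA -rmorphM -exprS.
Qed.

Lemma idemM i j : idem i * idem j = if i == j then idem j else 0.
Proof.
have -> : idem i * idem j = iota (d%:R^-1 * \sum_(k < d) (w j / w i) ^+ k) * idem j.
  rewrite [idem i]/idem mulr_suml [d%:R^-1 * _]mulr_sumr rmorph_sum mulr_suml.
  apply: eq_bigr => k _.
  rewrite -mulrA mulX_idem mulrA -rmorphM -mulrA; congr (iota (_ * _) * _).
  by rewrite expr_div_n mulrC.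
case: eqP => [->|/eqP ij]; last first.
  by rewrite (rootz_orth z_prim) 1?eq_sym // mulr0 rmorph0 mul0r.
under eq_bigr do rewrite divff ?(rootz_neq0 z_prim) // expr1n.
by rewrite sumr_const card_ord mulVf // rmorph1 mul1r.
Qed.
End Idempotents.

Section DeformedRoot.
Variables (I : finType) (C : fieldType) (d : nat) (z : C) (A : pzRingType).
Variables (iota : {rmorphism C -> A}) (T : A).
Hypotheses (z_prim : d.-primitive_root z) (dC : d%:R != 0 :> C).
Hypothesis iotaC : forall c a, iota c * a = a * iota c.
Hypothesis Td : T ^+ d = 1.
Local Notation w := (rootz z).
Variable U : 'I_d -> series I A.
Hypothesis UC : forall j f, U j * f = f * U j.
Hypothesis U0 : forall j, const_coef (U j) = iota (w j).
Local Notation e j := (seriesC I (idem z iota T (j : 'I_d))).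

(** The eigenvalues of [T] are moved from the roots of unity to the [U j],
    while the eigenspaces are kept. *)
Definition deformed_root : series I A := \sum_j U j * e j.

Lemma const_deformed_root : const_coef deformed_root = T.
Proof.
rewrite raddf_sum -[RHS]mulr1 -(sum_idem iota T z_prim dC) mulr_sumr.
apply: eq_bigr => j _; rewrite -[LHS]/(const_coef _) rmorphM /= U0 mul_idem //.
by rewrite /const_coef /= eqxx.
Qed.

Lemma deformed_root_idem j : deformed_root * e j = U j * e j.
Proof.
rewrite mulr_suml (bigD1 j) //= -mulrA -rmorphM /= idemM // eqxx big1 ?addr0 //.
by move=> i /negPf ij; rewrite -mulrA -rmorphM /= idemM // ij rmorph0 mulr0.
Qed.

Lemma idem_comm_deformed_root j : deformed_root * e j = e j * deformed_root.
Proof.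
rewrite mulr_suml mulr_sumr; apply: eq_bigr => i _.
rewrite mulrA -UC -!mulrA -!rmorphM; congr (_ * seriesC I _).
by rewrite !idemM // eq_sym; case: eqP => // ->.
Qed.

Lemma prod_deformed_root : \prod_(j < d) (deformed_root - U j) = 0.
Proof.
have e1 : \sum_i e i = 1.
  by rewrite -[LHS]rmorph_sum (sum_idem iota T z_prim dC) rmorph1.
rewrite -[LHS]mulr1 -[X in _ * X]e1 mulr_sumr big1 // => i _.
have : i \in index_enum 'I_d by rewrite mem_index_enum.
have ec j : GRing.comm (e i) (deformed_root - U j).
  by rewrite /GRing.comm mulrBr mulrBl idem_comm_deformed_root UC.
elim: (index_enum _) => // j r IH; rewrite inE big_cons => /orP[/eqP<-|/IH ir].
  have cr : GRing.comm (e i) (\prod_(j <- r) (deformed_root - U j)).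
    exact: commr_prod.
  rewrite -mulrA -cr mulrA mulrBl.
  by rewrite deformed_root_idem subrr mul0r.
by rewrite -mulrA ir mulr0.
Qed.
End DeformedRoot.


(** * The wallpaper groups *)

Definition point : Type := (int * int)%type.

(** Rotations of the plane, in coordinates on the lattice generated by [1] and
    by [i] for [E7], by a primitive cube root of unity for [E6] and [E8]; for
    [D4] all of them are half-turns.  The angle of the [k]-th one is
    [2 pi / d_k] up to sign and the centers are chosen so that the product is
    trivial. *)
Definition rotation (D : star) (k : nat) (v : point) : point :=
  let: (x, y) := v in
  match D, k with
  | D4, 0%N | D4, 3%N => (- x, - y)
  | D4, _ => (- x, - 1 - y)
  | E6, 0%N => (- y, x - y)
  | E6, 1%N => (- y - 1, x - y)
  | E6, _ => (- y, x - y + 1)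
  | E7, 0%N => (- x, - y)
  | E7, 1%N => (- y - 1, x)
  | E7, _ => (- y, x + 1)
  | E8, 0%N => (- x, - y)
  | E8, 1%N => (- y - 1, x - y)
  | E8, _ => (x - y + 1, x + 1)
  end.

Lemma point_eq (a b c d : int) : a = c -> b = d -> (a, b) = (c, d) :> point.
Proof. by move=> -> ->. Qed.

Lemma rotation_order D (k : 'I_(size (star_degrees D))) v :
  iter (nth 0%N (star_degrees D) k) (rotation D k) v = v.
Proof.
by case: v D k => x y [] [[|[|[|[|?]]]]] //= _; apply: point_eq; ring.
Qed.

Lemma rotation_prod D v :
  foldl (fun v (k : 'I_(size (star_degrees D))) => rotation D k v) v
    (index_enum 'I_(size (star_degrees D))) = v.
Proof.
have foldE n (f : nat -> point -> point) (r : seq 'I_n) w :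
    foldl (fun v k => f (nat_of_ord k) v) w r =
    foldl (fun v k => f k v) w (map val r).
  by elim: r w => //= k r IH w.
rewrite (foldE _ (rotation D)) /index_enum unlock -enumT val_enum_ord.
by case: v D => x y [] /=; apply: point_eq; ring.
Qed.

(** The commutator of two rotations with different centers is a nontrivial
    translation. *)
Lemma rotation_comm D x y :
  let d k := nth 0%N (star_degrees D) k in
  exists x', iter (d 1%N).-1 (rotation D 1%N) (iter (d 0%N).-1 (rotation D 0%N)
    (rotation D 1%N (rotation D 0%N (x, y)))) = (x', y - 2).
Proof.
by case: D => /=; eexists; apply: point_eq; try reflexivity; ring.
Qed.

(** Halved because the commutator translates by [2] in this coordinate. *)
Definition height (v : point) : int := (v.2 %/ 2)%Z.

Lemma heightB2 x y : height (x, y - 2) = height (x, y) - 1.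
Proof.
rewrite /height /=; have -> : y - 2 = -1 * 2 + y by ring.
by rewrite divzMDl // addrC.
Qed.

(** * The star algebras *)

Section ProdStar.
Variable A : pzRingType.

Definition star_first D : 'I_(size (star_degrees D)) :=
  match D return 'I_(size (star_degrees D)) with D4 => @ord0 3 | _ => @ord0 2 end.
Definition star_second D : 'I_(size (star_degrees D)) :=
  match D return 'I_(size (star_degrees D)) with
  | D4 => @Ordinal 4 1 isT | _ => @Ordinal 3 1 isT end.

Lemma val_star_first D : star_first D = 0%N :> nat. Proof. by case: D. Qed.
Lemma val_star_second D : star_second D = 1%N :> nat. Proof. by case: D. Qed.

Lemma prod_star D (F : 'I_(size (star_degrees D)) -> A) :
  \prod_k F k = F (star_first D) * F (star_second D) *
    \prod_(k < size (star_degrees D) | (1 < k)%N) F k.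
Proof.
have split2 n (G : 'I_n.+2 -> A) (k1 : 'I_n.+2) : k1 = 1%N :> nat ->
    \prod_k G k = G ord0 * G k1 * \prod_(k < n.+2 | (1 < k)%N) G k.
  move=> k1E; have -> : k1 = lift ord0 ord0 by apply: val_inj.
  by rewrite [X in _ * X]big_mkcond !big_ord_recl /= !mul1r mulrA.
by case: D F => F; apply: split2.
Qed.
End ProdStar.

Section LaurentInverse.
Variable F : fieldType.
Local Notation "x %:F" := (@FracField.tofrac {poly F} x).

Fact laurentV_proof : 1%:F / 'X%:F \in @laurent_pred F.
Proof. by apply/asboolP; exists 1, 1%N; rewrite expr1. Qed.
Definition laurentV : laurent F := Laurent laurentV_proof.

Lemma laurentXV : laurentX F * laurentV = 1.
Proof.
by apply: val_inj; rewrite /= rmorph1 mul1r mulfV // tofrac_eq0 polyX_eq0.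
Qed.
End LaurentInverse.

Lemma expr_predl (A : pzRingType) (x : A) n :
  (0 < n)%N -> x ^+ n = 1 -> x * x ^+ n.-1 = 1.
Proof. by move=> n0 <-; rewrite -exprS prednK. Qed.

Lemma expr_predr (A : pzRingType) (x : A) n :
  (0 < n)%N -> x ^+ n = 1 -> x ^+ n.-1 * x = 1.
Proof. by move=> n0 <-; rewrite -exprSr prednK. Qed.

Lemma commutator_inv (A : pzRingType) (a a' b b' : A) :
  a * a' = 1 -> a' * a = 1 -> b * b' = 1 -> b' * b = 1 ->
  a * b * a' * b' * (b * a * b' * a') = 1.
Proof.
move=> aa' a'a bb' b'b; rewrite -!mulrA [b' * (b * _)]mulrA b'b mul1r.
by rewrite [a' * (a * _)]mulrA a'a mul1r [b * (b' * _)]mulrA bb' mul1r.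
Qed.

Section Rotations.
Variables (R : realType) (D : star).
Local Notation m := (size (star_degrees D)).
Local Notation d k := (nth 0%N (star_degrees D) k).
Local Notation C := (complexes R).
Local Notation L := (laurent C).
Local Notation E := (fun_end_alg (B R D) point).

Lemma B_T_order (k : 'I_m) : B_T R k ^+ d k = 1.
Proof.
rewrite /B_T -rmorphXn -(rmorph1 (quot_proj _)).
by apply/quot_proj_eq/ideal_of_mem/B_rel_power.
Qed.

Lemma B_T_prod : \prod_(k < m) B_T R k = alg_scalar (B R D) (laurentX C).
Proof.
rewrite /B_T -rmorph_prod.
by apply/quot_proj_eq/ideal_of_mem/B_rel_prod.
Qed.

(** The rotation is added to the multiplication by [T_k] so that the commutator
    of the first two generators moves points without ever returning. *)
Definition rot_op (k : 'I_m) : E := twist (B_T R k) (rotation D k).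

Lemma rot_op_order k : rot_op k ^+ d k = 1.
Proof.
rewrite /rot_op [LHS]twistX B_T_order -twist_id; congr twist.
by apply/funext => v; apply: rotation_order.
Qed.

Lemma twist_prod (T : Type) (r : seq T) (a : T -> B R D) (s : T -> point -> point) :
  \prod_(k <- r) (twist (a k) (s k) : E) =
  twist (\prod_(k <- r) a k) (fun v => foldl (fun v k => s k v) v r).
Proof.
elim: r => [|k r IH]; first by rewrite !big_nil -[LHS]twist_id.
by rewrite !big_cons IH; apply: twistM.
Qed.

Lemma rot_op_prod : \prod_(k < m) rot_op k = alg_scalar E (laurentX C).
Proof.
rewrite twist_prod B_T_prod; apply/fun_endP => x v /=.
by rewrite rotation_prod.
Qed.

Local Notation k1 := (star_first D).
Local Notation k2 := (star_second D).
Local Notation rinv k := (iter (d k).-1 (rotation D k)).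

Lemma rotation_invl (k : 'I_m) : cancel (rotation D k) (rinv k).
Proof.
by move=> v; rewrite -iterSr prednK ?star_degree_gt0 // rotation_order.
Qed.

Lemma rotation_invr (k : 'I_m) : cancel (rinv k) (rotation D k).
Proof.
by move=> v; rewrite -iterS prednK ?star_degree_gt0 // rotation_order.
Qed.

(** The linear equation met in each degree, when [c] is the product of the
    other generators. *)
Lemma rot_op_surj (c : E) :
  rot_op k1 * rot_op k2 * c = alg_scalar E (laurentX C) ->
  forall X : E, exists Y1 Y2,
    (Y1 * rot_op k1 - rot_op k1 * Y1) * rot_op k2 * c +
    rot_op k1 * (Y2 * rot_op k2 - rot_op k2 * Y2) * c = X.
Proof.
move=> hc; apply: (@linearized_product_surj E _ (rot_op k1 ^+ (d k1).-1)
  _ (rot_op k2 ^+ (d k2).-1) c _ (alg_scalar E (laurentV C))) hc _ _ _.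
- by apply: expr_predl; [apply: star_degree_gt0 | apply: rot_op_order].
- by apply: expr_predr; [apply: star_degree_gt0 | apply: rot_op_order].
- by apply: expr_predl; [apply: star_degree_gt0 | apply: rot_op_order].
- by apply: expr_predr; [apply: star_degree_gt0 | apply: rot_op_order].
- exact: alg_central.
- by rewrite -rmorphM laurentXV rmorph1.
set a1 := B_T R k1; set a2 := B_T R k2.
set b1 := a1 ^+ (d k1).-1; set b2 := a2 ^+ (d k2).-1.
have a1b1 : a1 * b1 = 1.
  by apply: expr_predl; [apply: star_degree_gt0 | apply: B_T_order].
have b1a1 : b1 * a1 = 1.
  by apply: expr_predr; [apply: star_degree_gt0 | apply: B_T_order].
have a2b2 : a2 * b2 = 1.
  by apply: expr_predl; [apply: star_degree_gt0 | apply: B_T_order].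
have b2a2 : b2 * a2 = 1.
  by apply: expr_predr; [apply: star_degree_gt0 | apply: B_T_order].
move=> X; have [||||v|Y <-] := @adjoint_surj _ (B R D) point
  (a1 * a2 * b1 * b2) (a2 * a1 * b2 * b1)
  (rinv k2 \o (rinv k1 \o (rotation D k2 \o rotation D k1)))
  (rinv k1 \o (rinv k2 \o (rotation D k1 \o rotation D k2))) height _ _ _ _ _ X.
- exact: commutator_inv.
- exact: commutator_inv.
- by move=> v /=; rewrite rotation_invr rotation_invr rotation_invl rotation_invl.
- by move=> v /=; rewrite rotation_invr rotation_invr rotation_invl rotation_invl.
- case: v => x y /=; rewrite val_star_first val_star_second.
  by have [x' ->] := rotation_comm D x y; apply: heightB2.
by exists Y; rewrite /rot_op !twistX !twistM.
Qed.
End Rotations.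


Section Generators.
Variables (R : realType) (D : star).
Local Notation m := (size (star_degrees D)).
Local Notation d k := (nth 0%N (star_degrees D) k).
Local Notation C := (complexes R).
Local Notation L := (laurent C).
Local Notation F := (free_alg L 'I_m).
Local Notation E := (fun_end_alg (B R D) point).
Local Notation EE := (series_alg (param D) E).
Local Notation k1 := (star_first D).
Local Notation k2 := (star_second D).
Local Notation root n := (expi_frac R 1 n).

Lemma coef_hecke_u (k : 'I_m) (j : 'I_(d k)) :
  coef (hecke_u R j) 0 = rootz (root (d k)) j.
Proof.
rewrite /hecke_u coefM0 /= eqxx /rootz -expi_fracE.
have -> : (\sum_i (0%R : {ffun param D -> nat}) i = 0)%N.
  by rewrite big1 // => i _; rewrite ffunE.
by rewrite big_ord1 fact0 invr1 mul1r expr0 /= eqxx mulr1.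
Qed.

Definition scalarE : {rmorphism C -> E} :=
  (@alg_scalar L E \o @laurent_const C : {rmorphism C -> E}).

Definition hecke_root (k : 'I_m) (j : 'I_(d k)) : EE :=
  alg_scalar EE (series_map (@laurent_const C) (hecke_u R j)).

Lemma const_hecke_root (k : 'I_m) (j : 'I_(d k)) :
  const_coef (hecke_root j) = scalarE (rootz (root (d k)) j).
Proof. by rewrite -coef_hecke_u. Qed.

Lemma root_prim (k : 'I_m) : (d k).-primitive_root (root (d k)).
Proof. exact/expi_frac_prim/star_degree_gt0. Qed.

Lemma degree_neq0 (k : 'I_m) : (d k)%:R != 0 :> C.
Proof. by rewrite (@pnatr_eq0 R[i]) -lt0n star_degree_gt0. Qed.

Definition root_op (k : 'I_m) : EE :=
  deformed_root (root (d k)) scalarE (rot_op R k) (@hecke_root k).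

Lemma scalarE_central c (a : E) : scalarE c * a = a * scalarE c.
Proof. exact: alg_central. Qed.

Lemma hecke_root_central (k : 'I_m) (j : 'I_(d k)) (f : EE) :
  hecke_root j * f = f * hecke_root j.
Proof. exact: alg_central. Qed.

Lemma const_root_op k : const_coef (root_op k) = rot_op R k.
Proof.
apply: const_deformed_root; [exact: root_prim | exact: degree_neq0 | |
  exact: rot_op_order | exact: const_hecke_root].
exact: scalarE_central.
Qed.

Lemma prod_root_op (k : 'I_m) : \prod_(j < d k) (root_op k - hecke_root j) = 0.
Proof.
apply: prod_deformed_root; [exact: root_prim | exact: degree_neq0 | |
  exact: rot_op_order | exact: hecke_root_central].
exact: scalarE_central.
Qed.

(** Since the [U j] are central, conjugation preserves the relation
    [\prod_j (S - U j) = 0]. *)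
Lemma conj_prod (A : pzRingType) (g : series (param D) A * series (param D) A)
    (T : Type) (r : seq T) (S : series (param D) A) (U : T -> series (param D) A) :
  unip_pair g -> (forall j f, U j * f = f * U j) ->
  \prod_(j <- r) (conj_by g S - U j) = conj_by g (\prod_(j <- r) (S - U j)).
Proof.
move=> [gg' g'g _] UC; elim: r => [|j r IH].
  by rewrite !big_nil /conj_by mulr1 gg'.
have cSU : conj_by g S - U j = conj_by g (S - U j).
  by rewrite /conj_by mulrBr mulrBl -UC -[U j * _ * _]mulrA gg' mulr1.
rewrite !big_cons IH cSU /conj_by -!mulrA [g.2 * (g.1 * _)]mulrA g'g mul1r.
by rewrite !mulrA.
Qed.

Lemma star_late (k : 'I_m) : (1 < k)%N -> (k == k1) = false /\ (k == k2) = false.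
Proof.
rewrite -!val_eqE /= val_star_first val_star_second.
by case: (nat_of_ord k) => [|[]].
Qed.

(** The first two operators are conjugated by the solution of the product
    relation, the others keep the form given by [deformed_root]. *)
Lemma deformed_generators : exists t : 'I_m -> EE,
  [/\ forall k, const_coef (t k) = rot_op R k,
      forall k : 'I_m, \prod_(j < d k) (t k - hecke_root j) = 0
    & \prod_(k < m) t k = alg_scalar EE (seriesC (param D) (laurentX C))].
Proof.
pose rest : EE := \prod_(k < m | (1 < k)%N) root_op k.
pose Q : EE := alg_scalar EE (seriesC (param D) (laurentX C)).
have const_rel : rot_op R k1 * rot_op R k2 * const_coef rest =
    alg_scalar E (laurentX C).
  rewrite -rot_op_prod prod_star; congr (_ * _).
  by rewrite rmorph_prod; apply: eq_bigr => k _; apply: const_root_op.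
have [||g1 [g2 [u1 u2 gQ]]] :=
  @deform_product (param D) E (root_op k1) (root_op k2) rest Q.
- by rewrite !const_root_op [LHS]const_rel /const_coef /= eqxx.
- by rewrite !const_root_op; apply: rot_op_surj.
have k12 : k1 != k2.
  by rewrite -val_eqE /= val_star_first val_star_second.
pose t k := if k == k1 then conj_by g1 (root_op k)
            else if k == k2 then conj_by g2 (root_op k) else root_op k.
exists t; split=> [k|k|].
- rewrite /t; case: (k == k1); last case: (k == k2).
  + exact: etrans (const_coef_conj _ u1) (const_root_op k).
  + exact: etrans (const_coef_conj _ u2) (const_root_op k).
  exact: const_root_op.
- have conj0 g : conj_by g (0 : EE) = 0 by rewrite /conj_by mulr0 mul0r.
  have cp g : unip_pair g ->
      \prod_(j < d k) (conj_by g (root_op k) - hecke_root j) = 0.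
    move=> gu; rewrite (conj_prod _ _ gu (@hecke_root_central k)) prod_root_op.
    exact: conj0.
  rewrite /t; case: (k == k1); first exact: cp.
  by case: (k == k2); [apply: cp | apply: prod_root_op].
rewrite prod_star -/Q -gQ; congr (_ * _ * _).
- by rewrite /t eqxx.
- by rewrite /t eq_sym (negPf k12) eqxx.
apply: eq_bigr => k k_gt1; rewrite /t.
have [kn1 kn2] := star_late k_gt1.
by rewrite kn1 kn2.
Qed.
End Generators.

Lemma const_seriesC (I : finType) (A : pzRingType) (a : A) :
  const_coef (seriesC I a) = a.
Proof. by rewrite /const_coef /= eqxx. Qed.

Lemma const_prod_rel (I : finType) (K : comPzRingType) (A : algebra K)
    (T : Type) (r : seq T) (g : T -> A) (c : K) :
  const_coef (\prod_(k <- r) seriesC I (g k)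
    - alg_scalar (series_alg I A) (seriesC I c) : series I A) =
  \prod_(k <- r) g k - alg_scalar A c.
Proof.
rewrite rmorphB rmorph_prod; congr (_ - _); last by rewrite /const_coef /= eqxx.
by apply: eq_bigr => k _; apply: const_seriesC.
Qed.

(** Operators preserving the constant functions: it is enough to look at the
    generators. *)
Lemma const_fun_hom (L : comNzRingType) (X : choiceType) (A : algebra L)
    (Omega : Type) (h : {rmorphism free_alg L X -> fun_end A Omega})
    (p : {rmorphism free_alg L X -> A}) :
  (forall c, h (alg_scalar _ c) = alg_scalar (fun_end_alg A Omega) c) ->
  (forall c, p (alg_scalar _ c) = alg_scalar A c) ->
  (forall k x, fop (h (free_gen L k)) (fun=> x) = (fun=> p (free_gen L k) * x)) ->
  forall f x, fop (h f) (fun=> x) = (fun=> p f * x).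
Proof.
move=> hc pc hg f; elim/free_alg_ind: f => [c|k|f g IHf IHg|f g IHf IHg] x.
- by rewrite hc pc.
- exact: hg.
- by rewrite !rmorphD; apply/funext => v; rewrite /= IHf IHg -mulrDl.
by rewrite !rmorphM /= IHg IHf mulrA.
Qed.

Section Relations.
Variables (R : realType) (D : star).
Local Notation m := (size (star_degrees D)).
Local Notation d k := (nth 0%N (star_degrees D) k).
Local Notation C := (complexes R).
Local Notation L := (laurent C).
Local Notation F := (free_alg L 'I_m).
Local Notation E := (fun_end_alg (B R D) point).
Local Notation EE := (series_alg (param D) E).
Local Notation root n := (expi_frac R 1 n).

Lemma const_Hfree_roots (k : 'I_m) :
  const_coef (\prod_(j < d k) (Hfree_T R k - Hfree_u R j) : series (param D) F)
  = free_gen L k ^+ d k - 1.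
Proof.
pose iota : {rmorphism C -> F} :=
  (@alg_scalar L F \o @laurent_const C : {rmorphism C -> F}).
have iotaC c a : iota c * a = a * iota c by apply: alg_central.
rewrite -(prod_subr_rootz (free_gen L k) (@root_prim R D k) iotaC).
rewrite rmorph_prod; apply: eq_bigr => j _.
rewrite -coef_hecke_u rmorphB; congr (_ - _).
by rewrite /const_coef /= eqxx.
Qed.

Lemma const_Hfree_prod :
  const_coef (\prod_(k < m) Hfree_T R k
    - alg_scalar (Hfree R D) (seriesC (param D) (laurentX C)) : series (param D) F)
  = \prod_(k < m) free_gen L k - alg_scalar F (laurentX C).
Proof.
exact: const_prod_rel.
Qed.

Lemma H_rel_const (x : series_alg (param D) F) :
  @H_rel R D x -> const_coef x \in ideal_of (@B_rel R D).
Proof.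
case=> [k|]; apply: ideal_of_mem.
  rewrite [const_coef _]const_Hfree_roots; exact: B_rel_power.
rewrite [const_coef _]const_Hfree_prod; exact: B_rel_prod.
Qed.

Lemma H_rel_lift r : @B_rel R D r -> exists2 x, @H_rel R D x & const_coef x = r.
Proof.
case=> [k|].
  exists (\prod_(j < d k) (Hfree_T R k - Hfree_u R j)); first exact: H_rel_roots.
  exact: const_Hfree_roots.
exists (\prod_(k < m) Hfree_T R k
    - alg_scalar (Hfree R D) (seriesC (param D) (laurentX C))).
  exact: H_rel_prod.
exact: const_Hfree_prod.
Qed.

Section Representation.
Variable t : 'I_m -> EE.
Hypothesis t0 : forall k, const_coef (t k) = rot_op R k.
Hypothesis t_roots : forall k : 'I_m, \prod_(j < d k) (t k - hecke_root R j) = 0.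
Hypothesis t_prod :
  \prod_(k < m) t k = alg_scalar EE (seriesC (param D) (laurentX C)).

Local Notation EL := (Defs.restrict EE (@seriesC (param D) L)).
Definition rep : {rmorphism F -> series (param D) E} :=
  (@free_eval L 'I_m EL t : {rmorphism F -> EL}).

Lemma rep_scalar c : rep (alg_scalar F c) = seriesC (param D) (alg_scalar E c).
Proof.
rewrite [LHS]free_eval_scalar; apply/seriesP => e /=.
by case: eqP => // _; apply: rmorph0.
Qed.

Lemma rep_gen k : rep (free_gen L k) = t k.
Proof. exact: (@free_eval_gen L _ EL t). Qed.

Lemma rep_rel x : @H_rel R D x -> series_ext rep x = 0.
Proof.
have extT k : series_ext rep (Hfree_T R k) = t k.
  by rewrite [LHS]series_ext_seriesC rep_gen.
case=> [k|].
  rewrite -[RHS](t_roots k) rmorph_prod; apply: eq_bigr => j _.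
  rewrite rmorphB; congr (_ - _); first exact: extT.
  by rewrite [LHS](series_ext_scalar rep_scalar).
rewrite [LHS](rmorphB (series_ext rep)) rmorph_prod -[RHS](subrr (\prod_k t k)).
congr (_ - _); first by apply: eq_bigr => k _; apply: extT.
rewrite t_prod; exact: (series_ext_scalar rep_scalar).
Qed.

Lemma rep_const f x :
  fop (const_coef (rep f)) (fun=> x) =
  (fun=> quot_proj (ideal_of (@B_rel R D)) f * x).
Proof.
pose h : {rmorphism F -> fun_end (B R D) point} := const_coef \o rep.
apply: (const_fun_hom (h := h) (p := quot_proj (ideal_of (@B_rel R D)))) => [c|c|k y].
- by rewrite /h /= rep_scalar const_seriesC.
- by [].
by rewrite /h /= rep_gen t0.
Qed.
End Representation.

End Relations.



(** The normal form [psi] transports completeness and flatness from the power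
    series, and its constant term [red] identifies the special fiber.  The
    scalars are restricted from [L] to [C] on the way. *)
Section DeformationCriterion.
Variables (I : finType) (C : fieldType) (L : comPzRingType).
Variable iota : {rmorphism C -> L}.
Variables (H : algebra (series I L)) (A0 : algebra L).
Variables (psi : H -> series I A0) (red : {rmorphism H -> A0}).
Hypothesis psiD : forall x y, psi (x + y) = psi x + psi y.
Hypothesis psiZ : forall c x,
  psi (alg_scalar H c * x) = alg_scalar (series_alg I A0) c * psi x.
Hypothesis psi_bij : bijective psi.
Hypothesis psi_red : forall x, const_coef (psi x) = red x.
Hypothesis red_scalar : forall c,
  red (alg_scalar H (seriesC I c)) = alg_scalar A0 c.

Local Notation HC := (Defs.restrict H (series_map iota)).
Local Notation AC := (Defs.restrict A0 iota).

Let psiC (x : mod_of HC) : mod_of (series_alg I AC) := psi x.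

Let psiC_lin : linear psiC.
Proof. by move=> a x y; rewrite /psiC [LHS]psiD; congr (_ + _); apply: psiZ. Qed.

Let psiC_bij : bijective psiC. Proof. exact: psi_bij. Qed.

Lemma deformation_criterion : exists phi : {rmorphism special_fiber HC -> AC},
  flat_formal_deformation phi /\
  forall x : H, phi (special_fiber_proj (to_restrict (series_map iota) x)) =
                to_restrict iota (red x).
Proof.
pose red_C : {rmorphism HC -> AC} := red.
pose J1 := adic_ideal (aug_ideal I C) HC 1.
have redE x : (x \in J1) = (red_C x == 0).
  by rewrite [LHS](adic_psi psiC_lin psiC_bij) ord_ge1 -psi_red.
have red_ker : {in J1, forall x, red_C x = 0}.
  by move=> x; rewrite redE => /eqP.
pose phi : {rmorphism special_fiber HC -> AC} := quot_ind red_ker.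
have phiE x : phi (special_fiber_proj x) = red_C x by apply: quot_indE.
exists phi; split=> [|x]; last exact: phiE.
split; [exact: series_module_complete psiC_lin psiC_bij | 
  exact: series_module_flat psiC_lin psiC_bij |].
split.
  have phi_inj x y : phi x = phi y -> x = y.
    rewrite -[x]quot_liftK -[y]quot_liftK [phi _]phiE [phi _]phiE => xy.
    by apply/quot_proj_eq; rewrite redE rmorphB subr_eq0; apply/eqP.
  have phi_surj y : exists x, phi x = y.
    have [psi' _ psi'K] := psi_bij.
    exists (special_fiber_proj (psi' (seriesC I y) : HC)).
    by rewrite phiE -[LHS]psi_red psi'K /const_coef /= eqxx.
  have [g gK] := choice phi_surj.
  by exists g => [x|y]; [apply: phi_inj | ]; rewrite gK.
move=> c; rewrite -[alg_scalar (special_fiber _) c]/(special_fiber_proj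
  (alg_scalar HC (seriesC I c))) phiE.
rewrite -[RHS](red_scalar (iota c)); congr (red (alg_scalar H _)).
by apply/seriesP => e /=; case: eqP => // _; rewrite rmorph0.
Qed.
End DeformationCriterion.

Theorem theorem3p3 (R : realType) (D : star) :
  exists phi : {rmorphism special_fiber (Hhat_C R D) -> B_C R D},
    [/\ flat_formal_deformation phi,
        forall k : 'I_(size (star_degrees D)),
          phi (special_fiber_proj (Hhat_C_T R k)) = B_C_T R k
      & forall c : laurent (complexes R),
          phi (special_fiber_proj (Hhat_C_scalar (seriesC (param D) c)))
          = B_C_scalar D c].
Proof.
have [t [t0 t_roots t_prod]] := deformed_generators R D.
pose ev : {additive fun_end_alg (B R D) point -> B R D} :=
  (value_at ((0, 0) : point) : {additive fun_end (B R D) point -> B R D}).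
have evZ c x : ev (alg_scalar (fun_end_alg (B R D) point) c * x)
    = alg_scalar (B R D) c * ev x by [].
have ev_rep f : ev (const_coef (rep t f)) = quot_proj _ f.
  by rewrite /ev /= /value_at rep_const // mulr1.
have relP := rep_rel t_roots t_prod.
pose red : {rmorphism Hhat R D -> B R D} := reduction (@H_rel_const R D).
have redT k : red (Hhat_T R k) = B_T R k.
  by rewrite [LHS]reductionE /const_coef /= eqxx.
have red_scalar c :
    red (alg_scalar (Hhat R D) (seriesC (param D) c)) = alg_scalar (B R D) c.
  by rewrite [LHS]reductionE /const_coef /= eqxx.
have [phi [phi_flat phiE]] := deformation_criterion (@laurent_const (complexes R))
  (normal_formD ev relP) (normal_formZ evZ (rep_scalar t) relP)
  (normal_form_bij (@H_rel_lift R D) relP ev_rep)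
  (normal_form_const (@H_rel_const R D) relP ev_rep) red_scalar.
exists phi; split=> [|k|c]; first exact: phi_flat.
  exact: etrans (phiE _) (redT k).
exact: etrans (phiE _) (red_scalar c).
Qed.
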